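(* Let $0<\alpha<1/100$, $D^2Q<x^{\frac23-4\alpha}$, and $M_2\le x^{\frac13}$. Let $\kappa>0$ be a fixed real number. For all but at most $Q^{1-4\kappa+o(1)}$ integers $q\in[Q,2Q]$, $$\max_{(a,q)=1}|\mathcal D_{\mathcal M,f}(a,q)|\ll D^3x^\varepsilon\left(M_2^{\frac54}x^{\frac14}Q^{-\frac14}+M_2^{\frac34}x^{\frac14}\right)Q^{2\alpha+\kappa}+\frac{x}{Q^{1+\frac{\alpha}{2}}}$$ for any $\varepsilon$ with $0<\varepsilon<\alpha/4$.
   Context: Setting: $x$ is large; $\chi$ is an exceptional character of conductor $D$, i.e. a quadratic primitive Dirichlet character modulo $D$ such that $L(s,\chi)$ has a real zero $\beta\ge 1-C/\log(2D)$ for a fixed small constant $C>0$. For $i=1,2,3$ let $\mathcal M_i=[M_i,M_i(1+\Delta))$, where $0<\Delta\ll\frac{1}{\log^8x}$, and the real numbers $M_1,M_2,M_3$ satisfy, for the moduli $q\in[Q,2Q]$ under consideration, $$\frac{x}{\log^{12}x}<M_1M_2M_3\le x,\qquad \frac{x}{q^{\frac32+\alpha}}\le M_3\le M_2\le M_1\le Dq^{1+\alpha}.$$ Write $\mathcal M=(\mathcal M_1,\mathcal M_2,\mathcal M_3)$. Let $f=(f_1,f_2,f_3)$, where exactly one of the $f_i$ is $\chi$ and the other two are identically $1$. For $(a,q)=1$ define $$\mathcal D_{\mathcal M,f}(a,q)=\sum_{\substack{t_1\in\mathcal M_1,\ t_2\in\mathcal M_2,\ t_3\in\mathcal M_3\\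 t_1t_2t_3\equiv a\ (\mathrm{mod}\ q)}}f_1(t_1)f_2(t_2)f_3(t_3),$$ the sum being over integers $t_i$. The term $o(1)$ tends to $0$ as $Q\to\infty$; the implied constant depends only on $\alpha,\kappa,\varepsilon$ (and the constant in the bound for $\Delta$). *)

(* Defs.v *)
From HB Require Import structures.
From mathcomp Require Import all_boot all_order all_algebra.
From mathcomp Require Import all_classical all_reals all_analysis.

Set Implicit Arguments.
Unset Strict Implicit.
Unset Printing Implicit Defensive.

Import Order.TTheory GRing.Theory Num.Theory.
Import numFieldNormedType.Exports.

Local Open Scope classical_set_scope.
Local Open Scope ring_scope.

(* Real-valued Dirichlet characters: a quadratic character only takes the
   values -1, 0 and 1, so no complex codomain is needed here. *)
Record dirichlet_character (R : realType) (D : nat) (chi : int -> R) : Prop :=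
  DirichletCharacter {
    dirichlet_modulus_gt0 : (0 < D)%N ;
    dirichlet_mul : forall m n : int, chi (m * n) = chi m * chi n ;
    dirichlet_periodic :
      forall m n : int, (m = n %[mod D])%Z -> chi m = chi n ;
    dirichlet_support : forall n : int, (chi n != 0) = coprimez n D }.

(* chi ^ 2 is principal while chi is not. *)
Definition quadratic_character (R : realType) (D : nat) (chi : int -> R)
    : Prop :=
  (forall n : int, coprimez n D -> chi n ^+ 2 = 1) /\
  (exists2 n : int, coprimez n D & chi n != 1).

Definition induced_modulus (R : realType) (D : nat) (chi : int -> R) (d : nat)
    : Prop :=
  (d %| D)%N /\
  forall n : int, coprimez n D -> (n = 1 %[mod d])%Z -> chi n = 1.

Definition primitive_character (R : realType) (D : nat) (chi : int -> R)
    : Prop :=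
  forall d : nat, induced_modulus D chi d -> d = D.

(* [dirichletL_is chi s v] says L(s, chi) = v, for real s > 0: there the
   Dirichlet series of a non-principal character converges (conditionally if
   s <= 1), and its sum is the value of the analytic continuation.  Convergence
   is part of the assertion, as [lim] of a divergent series is a dummy value. *)
Definition dirichletL_is (R : realType) (chi : int -> R) (s v : R) : Prop :=
  0 < s /\
  series (fun n : nat => chi n.+1%:Z / n.+1%:R `^ s) @ \oo --> v.

Definition exceptional_character (R : realType) (C : R) (D : nat)
    (chi : int -> R) : Prop :=
  [/\ dirichlet_character D chi,
      quadratic_character D chi,
      primitive_character D chi &
      exists2 beta : R, 1 - C / ln (2 * D%:R) <= beta &
                        dirichletL_is chi beta 0].

Definition one_twist (R : realType) (chi f1 f2 f3 : int -> R) : Prop :=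
  [\/ [/\ f1 =1 chi, f2 =1 cst 1 & f3 =1 cst 1],
      [/\ f1 =1 cst 1, f2 =1 chi & f3 =1 cst 1] |
      [/\ f1 =1 cst 1, f2 =1 cst 1 & f3 =1 chi]].

Definition in_window (R : realType) (Delta M : R) (t : int) : Prop :=
  M <= t%:~R < M * (1 + Delta).

(* The index set is finite, so the finitely supported sum is the plain sum. *)
Definition ternary_sum (R : realType) (Delta M1 M2 M3 : R)
    (f1 f2 f3 : int -> R) (a : int) (q : nat) : R :=
  \sum_(t \in [set t : int * int * int |
          [/\ in_window Delta M1 t.1.1,
              in_window Delta M2 t.1.2,
              in_window Delta M3 t.2 &
              (t.1.1 * t.1.2 * t.2 = a %[mod q])%Z]])
    (f1 t.1.1 * f2 t.1.2 * f3 t.2).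

(* The sum depends on a only modulo q, so the maximum over all a coprime to q
   is taken over representatives; the values being nonnegative, 0 is neutral. *)
Definition max_ternary_sum (R : realType) (Delta M1 M2 M3 : R)
    (f1 f2 f3 : int -> R) (q : nat) : R :=
  \big[Num.max/0]_(a < q | coprime a q)
    `|ternary_sum Delta M1 M2 M3 f1 f2 f3 a%:Z q|.

Definition admissible_modulus (R : realType) (alpha x : R) (D : nat)
    (M1 M3 : R) (q : nat) : Prop :=
  x / q%:R `^ (3 / 2 + alpha) <= M3 /\ M1 <= D%:R * q%:R `^ (1 + alpha).

(* Main.v *)
Require Import Defs.
From HB Require Import structures.
From mathcomp Require Import all_boot all_order all_algebra.
From mathcomp Require Import all_classical all_reals all_analysis.
From mathcomp Require Import complex zify ring lra.

(** Write [t1 = a / (t2 t3)] modulo [q] and expand in additive characters: with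
    [A(h) = sum f1(t1) e(h t1 / q)] and [P(h) = sum f2(t2) e(- h a / (t2 q))],
    [q S = sum_h sum_t3 f3(t3) A(h t3) P(h)].

    Frequencies with [h D <> 0] modulo [q].  As [f1] has period [D], [A(h)] is at
    most [min (M1, D q / |h D|)].  Cut [|h D t3|] into dyadic ranges of size [K] and
    let [nu(h)] count the [t3] in the range.  By Hoelder,
    [(sum nu |P|)^4 <= (sum nu)^2 (sum nu^2) (sum |P|^4)]; the divisor bound controls
    [sum nu^2], and [sum |P|^4 <= q J(q)], where [J(q)] counts the solutions of
    [1/s1 + 1/s2 = 1/s3 + 1/s4] modulo [q] with [s_i <= 2 M2].  Clearing denominators
    and using the divisor bound again, the average of [J(q)] over [q] in [[Q, 2Q]] is
    at most [Q^o(1) (M2^2 + M2^4 / Q)], so [J(q)] exceeds [Q^(4 kappa)] times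
    [M2^2 + M2^4 / Q] for at most [Q^(1 - 4 kappa + o(1))] moduli.

    Frequencies with [h D = 0].  If [f1 = 1], only [h = 0] remains and the sum of
    [chi] over one of the other two windows is small.  If [f1 = chi] and [D] does not
    divide [q], [A(h)] is an incomplete sum of a periodic function whose full period
    sum vanishes, by primitivity.  If [D] divides [q], the congruence gives
    [chi t1 = chi a * chi t2 * chi t3], which reduces to the first case. *)

Set Implicit Arguments.
Unset Strict Implicit.
Unset Printing Implicit Defensive.

Import Order.TTheory GRing.Theory Num.Theory.
Import numFieldNormedType.Exports.

Local Open Scope classical_set_scope.
Local Open Scope ring_scope.

(** * Divisor bounds *)

Lemma succ_le_pow (R : realType) (eps : R) : 0 < eps ->
  exists2 B : R, 1 <= B & forall a : nat, a.+1%:R <= B * (2 ^ a)%:R `^ eps.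
Proof.
move=> eps_gt0; have ln2 : 0 < ln 2 :> R by rewrite ln_gt0 // ltr1n.
set c := eps * ln 2; have c_gt0 : 0 < c by rewrite mulr_gt0.
exists (1 + c^-1); first by rewrite lerDl invr_ge0 ltW.
move=> a; rewrite natrX -powR_mulrn // -powRrM /powR.
rewrite pnatr_eq0 /= -mulrA -/c.
apply: le_trans (_ : (1 + c^-1) * (1 + a%:R * c) <= _); last first.
  by rewrite ler_wpM2l ?expR_ge1Dx // addr_ge0 // invr_ge0 ltW.
rewrite mulrDl mul1r mulrDr mulr1 (mulrCA _^-1) mulVf ?gt_eqF // mulr1.
rewrite -addn1 natrD; have := invr_gt0 c; rewrite c_gt0 => cV.
have : 0 <= a%:R * c by rewrite mulr_ge0 // ltW.
lra.
Qed.

Lemma primepow_cofactor (p n : nat) : prime p -> (0 < n)%N -> (p %| n)%N ->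
  exists a m, [/\ n = (p ^ a.+1 * m)%N, ~~ (p %| m)%N & (0 < m)%N].
Proof.
move=> pr_p n_gt0 pn; case: (@pfactor_coprime p n pr_p n_gt0) => m cpm en.
have : (0 < logn p n)%N by rewrite logn_gt0 mem_primes pr_p n_gt0 pn.
case el: (logn p n) en => [//|a] en _; exists a, m; split.
- by rewrite mulnC.
- by rewrite -prime_coprime.
- by move: n_gt0; rewrite en muln_gt0 => /andP[].
Qed.

(* Each prime power [p ^ a] exactly dividing [n] costs a factor [a + 1], which
   is at most [p ^ (a * eps)] as soon as [p ^ eps >= 2]. *)
Lemma multiplicative_growth (R : realType) (eps : R) : 0 < eps ->
  exists2 C : R, 1 <= C &
  forall P : nat -> R -> Prop,
    (forall n (B B' : R), B <= B' -> P n B -> P n B') ->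
    (forall p a m (B : R), prime p -> ~~ (p %| m)%N -> (0 < m)%N -> 0 <= B -> P m B ->
       P (p ^ a.+1 * m)%N (a.+2%:R * B)) ->
    forall A : R, 0 <= A -> P 1%N A ->
    forall n, (0 < n)%N -> P n (A * C * n%:R `^ eps).
Proof.
move=> eps_gt0; have [B B1 HB] := succ_le_pow eps_gt0.
have B0 : 0 < B by apply: lt_le_trans B1.
pose Y := (Num.truncn (2 `^ eps^-1 : R)).+1.
have HY p : (Y <= p)%N -> 2 <= p%:R `^ eps :> R.
  move=> Yp; have h : 2 `^ eps^-1 <= p%:R :> R.
    by rewrite ltW // (lt_le_trans (truncnS_gt _)) // ler_nat.
  have -> : (2 : R) = (2 `^ eps^-1) `^ eps.
    by rewrite -powRrM mulVf ?gt_eqF // powRr1.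
  by apply: ge0_ler_powR => //; rewrite ?nnegrE ?powR_ge0 // ltW.
exists (B ^+ Y); first exact: exprn_ege1.
move=> P Pmono Pstep A A0 PA n n_gt0.
suff main y : forall n, (0 < n)%N -> (forall p, prime p -> (p %| n)%N -> (p < y)%N) ->
    P n (A * B ^+ minn y Y * n%:R `^ eps).
  apply: Pmono (main n.+1 n n_gt0 _).
    rewrite ler_wpM2r ?powR_ge0 // ler_wpM2l // ler_weXn2l //; exact: geq_minr.
  by move=> p _ /dvdn_leq; apply.
elim: y => {n n_gt0} [|y IH] n n_gt0 small.
  case: (ltnP 1 n) => n1.
    by have := small _ (pdiv_prime n1) (pdiv_dvd n).
  have -> : n = 1%N by lia.
  by rewrite min0n expr0 mulr1 powR1 mulr1.
have mono : B ^+ minn y Y <= B ^+ minn y.+1 Y.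
  by rewrite ler_weXn2l //; lia.
have [/andP[pr_y yn]|ny] := boolP (prime y && (y %| n)%N); last first.
  apply: Pmono (IH n n_gt0 _).
    by rewrite ler_wpM2r ?powR_ge0 // ler_wpM2l.
  move=> p pr_p pn; have := small p pr_p pn; rewrite ltnS leq_eqVlt => /orP[/eqP e|//].
  by move: ny; rewrite -e pr_p pn.
have [a [m [en ym m_gt0]]] := primepow_cofactor pr_y n_gt0 yn.
have IHm : P m (A * B ^+ minn y Y * m%:R `^ eps).
  apply: IH => // p pr_p pm; have pn : (p %| n)%N by rewrite en dvdn_mull.
  have := small p pr_p pn; rewrite ltnS leq_eqVlt => /orP[/eqP e|//].
  by move: ym; rewrite -e pm.
have Z0 : 0 <= A * B ^+ minn y Y * m%:R `^ eps.
  by rewrite !mulr_ge0 ?powR_ge0 // exprn_ge0 // ltW.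
rewrite {1}en; apply: Pmono (Pstep y a m _ pr_y ym m_gt0 Z0 IHm).
have -> : n%:R `^ eps = (y ^ a.+1)%:R `^ eps * m%:R `^ eps :> R.
  by rewrite en natrM powRM.
have Ba : 0 <= B ^+ minn y Y by rewrite exprn_ge0 // ltW.
set b := B ^+ minn y Y in Ba Z0 *; set b' := B ^+ _; set w := m%:R `^ eps.
suff h : a.+2%:R * b <= b' * (y ^ a.+1)%:R `^ eps.
  rewrite -(mulrA A b) (mulrCA _ A) -(mulrA A b') ler_wpM2l // !mulrA.
  by rewrite ler_wpM2r ?powR_ge0.
rewrite /b'; case: (leqP Y y) => Yy.
  have -> : minn y.+1 Y = minn y Y by lia.
  rewrite mulrC ler_wpM2l //.
  rewrite natrX -powR_mulrn // -powRrM mulrC powRrM powR_mulrn ?powR_ge0 //.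
  apply: le_trans (_ : 2 ^+ a.+1 <= _).
    by rewrite -natrX ler_nat ltn_expl.
  by rewrite lerXn2r ?nnegrE ?powR_ge0 // HY.
have -> : minn y.+1 Y = (minn y Y).+1 by lia.
rewrite exprSr -/b -mulrA mulrC ler_wpM2l //.
apply: le_trans (HB a.+1) _; rewrite ler_wpM2l ?(ltW B0) //.
apply: ge0_ler_powR; rewrite ?nnegrE ?(ltW eps_gt0) // ler_nat leq_exp2r //.
exact: prime_gt1.
Qed.

Definition tau (n : nat) : nat := size (divisors n).

Lemma tau_primepow (p a m : nat) : prime p -> (0 < m)%N ->
  (tau (p ^ a * m) <= a.+1 * tau m)%N.
Proof.
move=> pr_p m_gt0; have p0 := prime_gt0 pr_p.
have -> : (a.+1 * tau m = size [seq (p ^ i * d)%N | i <- iota 0 a.+1, d <- divisors m])%N.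
  by rewrite size_allpairs size_iota.
apply: (uniq_leq_size (divisors_uniq _)) => d.
have n0 : (0 < p ^ a * m)%N by rewrite muln_gt0 expn_gt0 p0.
rewrite -dvdn_divisors // => dv.
have d0 : (0 < d)%N := dvdn_gt0 n0 dv.
have g0 : (0 < gcdn d (p ^ a))%N by rewrite gcdn_gt0 d0.
have dm : (d %/ gcdn d (p ^ a) %| m)%N.
  rewrite -(@Gauss_dvdr _ (p ^ a %/ gcdn d (p ^ a))); last first.
    rewrite /coprime -(eqn_pmul2l g0) muln1 muln_gcdr ![(gcdn d _ * _)%N]mulnC.
    by rewrite !divnK ?dvdn_gcdl ?dvdn_gcdr.
  by rewrite -(dvdn_pmul2l g0) mulnA ![(gcdn d _ * _)%N]mulnC !divnK ?dvdn_gcdl ?dvdn_gcdr.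
have /(dvdn_pfactor _ _ pr_p)[i ia gi] := dvdn_gcdr d (p ^ a).
apply/allpairsP; exists (i, (d %/ gcdn d (p ^ a))%N); split => /=.
- by rewrite -[0%N :: _]/(iota 0 a.+1) mem_iota.
- by rewrite -dvdn_divisors.
- by rewrite -gi mulnC divnK ?dvdn_gcdl.
Qed.

Lemma tau_gt0 (n : nat) : (0 < tau n)%N.
Proof. by have := divisor1 n; rewrite /tau; case: (divisors n). Qed.

Lemma tau_bound (R : realType) (eps : R) : 0 < eps ->
  exists2 C : R, 1 <= C &
    forall n, (0 < n)%N -> (tau n)%:R <= C * n%:R `^ eps.
Proof.
move=> /multiplicative_growth[C C1 H]; exists C => // n n_gt0.
rewrite -(mul1r C).
apply: (H (fun n B => (tau n)%:R <= B)) => //.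
- by move=> ? B B' BB' /le_trans; apply.
- move=> p a m B pr_p _ m_gt0 B0 tB.
  apply: le_trans (_ : (a.+2 * tau m)%:R <= _); first by rewrite ler_nat tau_primepow.
  by rewrite natrM ler_wpM2l.
Qed.

Lemma sum_multiples (V : nmodType) (F : nat -> V) (p n : nat) : (0 < p)%N ->
  \sum_(t < n | (p %| t.+1)%N) F t.+1 = \sum_(t < n %/ p) F (p * t.+1)%N.
Proof.
move=> p0; elim: n => [|n IH]; first by rewrite div0n !big_ord0.
rewrite big_mkcond big_ord_recr /= -big_mkcond /= IH divnS //.
case: (boolP (p %| n.+1)%N) => [pn|_]; last by rewrite addr0 add0n.
rewrite add1n big_ord_recr /=; congr (_ + F _).
by have := divnK pn; rewrite divnS // pn add1n mulnC.
Qed.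

Lemma coprime_char_sum (R : realType) (eps : R) : 0 < eps ->
  exists2 C : R, 1 <= C & forall (chi : nat -> R) (D : R),
  (forall m n, chi (m * n)%N = chi m * chi n) -> (forall n, `|chi n| <= 1) ->
  (forall n, `|\sum_(t < n) chi t.+1| <= D) ->
  forall q, (0 < q)%N -> forall n,
  `|\sum_(t < n | coprime t.+1 q) chi t.+1| <= D * C * q%:R `^ eps.
Proof.
move=> /multiplicative_growth[C C1 H]; exists C => // chi D chiM chi1 sumD q q_gt0.
apply: (H (fun q B => forall n, `|\sum_(t < n | coprime t.+1 q) chi t.+1| <= B)) => //.
- by move=> ? B B' BB' h n; apply: le_trans (h n) BB'.
- move=> p a m B pr_p pm m_gt0 B0 h n; have p0 := prime_gt0 pr_p.
  have e t : coprime t (p ^ a.+1 * m) = coprime t m && ~~ (p %| t)%N.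
    by rewrite coprimeMr coprime_pexpr // coprime_sym prime_coprime // andbC.
  have e1 : \sum_(t < n | coprime t.+1 (p ^ a.+1 * m)) chi t.+1 =
      \sum_(t < n | coprime t.+1 m) chi t.+1 -
      chi p * \sum_(t < n %/ p | coprime t.+1 m) chi t.+1.
    apply/eqP; rewrite eq_sym subr_eq eq_sym.
    rewrite [X in _ == X](bigID (fun t : 'I_n => ~~ (p %| t.+1)%N)) /=; apply/eqP; congr (_ + _).
      by apply: eq_bigl => t; rewrite e.
    under [RHS]eq_bigl do rewrite negbK andbC.
    rewrite big_mkcondr /= (sum_multiples (fun t => if coprime t m then chi t else 0)) //.
    rewrite mulr_sumr [LHS]big_mkcond /=; apply: eq_bigr => t _.
    have cpm : coprime p m by rewrite prime_coprime.
    by rewrite coprimeMl cpm chiM.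
  rewrite e1; apply: le_trans (ler_normB _ _) _.
  apply: le_trans (_ : B + 1 * B <= _); first by rewrite lerD // normrM ler_pM.
  by rewrite mul1r -mulr2n -[_ *+ 2]mulr_natl ler_wpM2r // ler_nat.
- by apply: le_trans (normr_ge0 _) (sumD 0%N).
- by move=> n; under eq_bigl do rewrite coprimen1; apply: sumD.
Qed.

(** * Additive energy of inverses *)

Lemma card_inj_seq (T : finType) (U : eqType) (A : pred T) (f : T -> U) (s : seq U) :
  {in A &, injective f} -> (forall x, A x -> f x \in s) -> (#|A| <= size s)%N.
Proof.
move=> finj fs; rewrite cardE -(size_map f).
apply: uniq_leq_size => [|y /mapP[x]]; last by rewrite mem_enum => /fs ? ->.
rewrite map_inj_in_uniq ?enum_uniq // => x y; rewrite !mem_enum; exact: finj.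
Qed.

Section InverseEnergy.
Local Open Scope nat_scope.

(* Counts [1/s1 + 1/s2 = 1/s3 + 1/s4] modulo [q], with denominators cleared. *)
Definition inverse_energy (N q : nat) : nat :=
  \sum_(k : 'I_N * 'I_N) \sum_(i : 'I_N * 'I_N)
   ((i.1.+1 + i.2.+1) * (k.1.+1 * k.2.+1) ==
    (k.1.+1 + k.2.+1) * (i.1.+1 * i.2.+1) %[mod q]).

(* [(s1 + s2) B = A s1 s2] factors as [(A s1 - B) (A s2 - B) = B ^ 2]. *)
Lemma inverse_energy_diagonal (N A B d : nat) : 0 < A -> 0 < B ->
  (tau (B ^ 2) <= d) ->
  \sum_(i : 'I_N * 'I_N) ((i.1.+1 + i.2.+1) * B == A * (i.1.+1 * i.2.+1)) <= d.
Proof.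
move=> A0 B0 /(leq_trans _); apply; rewrite -big_mkcond /= sum1_card.
have fact (i j : nat) : (i.+1 + j.+1) * B = A * (i.+1 * j.+1) ->
    B < A * i.+1 /\ (A * i.+1 - B) * (A * j.+1 - B) = B ^ 2.
  move=> e; have lt1 : B < A * i.+1 by nia.
  have lt2 : B < A * j.+1 by nia.
  split=> //; have [u eu] : exists u, A * i.+1 = B + u by exists (A * i.+1 - B); lia.
  have [v ev] : exists v, A * j.+1 = B + v by exists (A * j.+1 - B); lia.
  rewrite eu ev !addKn expnS expn1.
  have : A * ((i.+1 + j.+1) * B) = (A * i.+1) * (A * j.+1) by rewrite e; lia.
  rewrite eu ev; have : A * ((i.+1 + j.+1) * B) = (A * i.+1 + A * j.+1) * B by lia.
  by rewrite eu ev; nia.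
apply: (@card_inj_seq _ _ _ (fun i : 'I_N * 'I_N => A * i.1.+1 - B)).
  move=> [i j] [i' j']; rewrite !unfold_in /= => /eqP/fact[h1 e1] /eqP/fact[h1' e1'] e.
  have ei : i = i' :> nat.
    have : A * i.+1 = A * i'.+1 by lia.
    by move/eqP; rewrite eqn_pmul2l // => /eqP[].
  have u0 : 0 < A * i.+1 - B by lia.
  have ej : j = j' :> nat.
    move: e1; rewrite -e1' e => /eqP; rewrite -e eqn_pmul2l // => /eqP e2.
    have : A * j.+1 = A * j'.+1.
      have := fact i j; have := fact i' j'; nia.
    by move/eqP; rewrite eqn_pmul2l // => /eqP[].
  by congr (_, _); apply: val_inj.
move=> [i j] /eqP/fact[_ e].
by rewrite -dvdn_divisors ?expn_gt0 ?B0 // -e dvdn_mulr.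
Qed.

Lemma inverse_energy_sum (Qs : seq nat) (N d : nat) : uniq Qs ->
  (forall n, 0 < n -> n <= 2 * N ^ 4 -> tau n <= d) ->
  \sum_(q <- Qs) inverse_energy N q <= size Qs * (N ^ 2 * d) + N ^ 4 * d.
Proof.
move=> uQ taud; rewrite /inverse_energy exchange_big /=.
apply: leq_trans (_ : \sum_(k : 'I_N * 'I_N) (size Qs * d + N ^ 2 * d) <= _); last first.
  rewrite sum_nat_const card_prod card_ord; lia.
apply: leq_sum => k _; rewrite exchange_big /=.
set A := _ + _; set B := k.1.+1 * _.
have bnd : B <= N ^ 2 by rewrite leq_mul //.
have bA : A <= 2 * N by have := ltn_ord k.1; have := ltn_ord k.2; rewrite /A; lia.
have N1 : 0 < N by have := ltn_ord k.1; lia.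
apply: leq_trans (_ : \sum_(i : 'I_N * 'I_N)
   (size Qs * ((i.1.+1 + i.2.+1) * B == A * (i.1.+1 * i.2.+1)) + d) <= _); last first.
  rewrite big_split /= -big_distrr /= leq_add //.
    rewrite leq_mul2l inverse_energy_diagonal ?orbT //.
    apply: taud; first by rewrite expn_gt0.
    apply: leq_trans (_ : (N ^ 2) ^ 2 <= _); first by rewrite leq_exp2r.
    by rewrite -expnM; lia.
  by rewrite sum_nat_const card_prod card_ord; lia.
apply: leq_sum => i _; set u := _ * B; set v := A * _.
have [e|ne] := eqVneq u v.
  rewrite e; under eq_bigr do rewrite eqxx.
  by rewrite sum1_size muln1 leq_addr.
rewrite muln0 add0n -big_mkcond /= -big_filter sum1_size.
pose n := (u - v) + (v - u).
have n0 : 0 < n by move/eqP: ne; rewrite /n; lia.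
have bi : i.1.+1 * i.2.+1 <= N ^ 2 by rewrite leq_mul //.
have bi2 : i.1.+1 + i.2.+1 <= 2 * N by have := ltn_ord i.1; have := ltn_ord i.2; lia.
have bu : u <= 2 * N * N ^ 2 by rewrite leq_mul.
have bv : v <= 2 * N * N ^ 2 by rewrite leq_mul.
apply: leq_trans (taud n n0 _); last first.
  have : 2 * N * N ^ 2 <= 2 * N ^ 4 by rewrite -mulnA leq_mul2l -expnS leq_pexp2l.
  by rewrite /n; lia.
apply: uniq_leq_size => [|q]; first exact: filter_uniq.
rewrite mem_filter => /andP[/eqP e _]; rewrite -dvdn_divisors //.
case: (leqP v u) => vu.
  by rewrite (_ : n = u - v); [rewrite -eqn_mod_dvd // e | rewrite /n; lia].
by rewrite (_ : n = v - u); [rewrite -eqn_mod_dvd ?(ltnW vu) // e | rewrite /n; lia].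
Qed.
End InverseEnergy.

(** * Counting in residue rings *)

Section Fibers.
Variables (q : nat).
Hypothesis q1 : (1 < q)%N.

Lemma Zq_lt (h : 'Z_q) : (h < q)%N.
Proof. by have := ltn_ord h; rewrite [X in (_ < X)%N]Zp_cast. Qed.

Lemma Zq_natr_val (h : 'Z_q) : (h : nat)%:R = h.
Proof. exact: natr_Zp. Qed.

Lemma Zq_natr_eq (m n : nat) : ((m%:R : 'Z_q) == n%:R) = (m == n %[mod q]).
Proof. by rewrite -val_eqE /= !val_Zp_nat. Qed.

Lemma Zq_unit (n : nat) : ((n%:R : 'Z_q) \is a GRing.unit) = coprime n q.
Proof. by rewrite unitZpE // coprime_sym. Qed.

Lemma Zq_opp_val (x : 'Z_q) : (0 < (x : nat))%N -> ((- x)%R : nat) = (q - x)%N.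
Proof.
move=> x0; have xq := Zq_lt x.
have -> : - x = (q - x)%N%:R.
  apply/eqP; rewrite eq_sym -subr_eq0 opprK -{2}(natr_Zp x) -natrD subnK ?(ltnW xq) //.
  by rewrite pchar_Zp.
by rewrite val_Zp_nat // modn_small //; lia.
Qed.

Lemma Zq_mul_inj (D : nat) (h h' : 'Z_q) : h * D%:R = h' * D%:R ->
  ((h * D) %/ q = (h' * D) %/ q)%N -> (0 < D)%N -> h = h'.
Proof.
move=> e ed D0; apply/val_inj/eqP; rewrite -(eqn_pmul2r D0).
rewrite (divn_eq (h * D) q) (divn_eq (h' * D) q) ed eqn_add2l -Zq_natr_eq.
by rewrite !natrM !Zq_natr_val; apply/eqP.
Qed.

Lemma Zq_mul_quot (D : nat) (h : 'Z_q) : (0 < D)%N -> ((h * D) %/ q)%N \in iota 0 D.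
Proof.
by move=> D0; rewrite mem_iota /= ltn_divLR ?(ltnW q1) // mulnC ltn_pmul2l // Zq_lt.
Qed.

Lemma card_mul_kernel (D : nat) : (0 < D)%N -> (#|[pred h : 'Z_q | (h * D%:R == 0)%R]| <= D)%N.
Proof.
move=> D0; rewrite -[leqRHS](size_iota 0).
apply: (@card_inj_seq _ _ _ (fun h : 'Z_q => (h * D) %/ q)%N) => [h h'|h _].
  by rewrite !inE => /eqP e /eqP e' ed; apply: (Zq_mul_inj _ ed D0); rewrite e e'.
exact: Zq_mul_quot.
Qed.

Variables (N D K : nat) (T : pred nat).
Hypothesis D0 : (0 < D)%N.
Hypothesis TN : forall t, T t -> (0 < t)%N && coprime t q.

Definition near_zero_count (h : 'Z_q) : nat :=
  \sum_(t < N.+1 | T t) (0 < (h * D%:R * t%:R)%R < K)%N.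

Lemma sum_near_zero_count : (\sum_h near_zero_count h <= N.+1 * (K * D))%N.
Proof.
rewrite /near_zero_count exchange_big /= -[X in (_ <= X * _)%N]card_ord -sum_nat_const.
rewrite big_mkcond /=; apply: leq_sum => t _; case: ifP => // /TN/andP[t0 ct].
rewrite -big_mkcond /= sum1_card -[K in leqRHS](size_iota 0) -[D in leqRHS](size_iota 0).
rewrite -(size_allpairs pair).
apply: (@card_inj_seq _ _ _ (fun h : 'Z_q => ((h * D%:R * t%:R)%R : nat, (h * D) %/ q)%N)).
  move=> h h' _ _ [] e ed; apply: (Zq_mul_inj (D := D)) => //.
  by apply: (mulIr (x := t%:R)); rewrite ?Zq_unit //; apply: val_inj.
move=> h /andP[_ hK]; apply/allpairsP; exists ((h * D%:R * t%:R)%R : nat, (h * D) %/ q)%N.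
by split => //; [rewrite mem_iota | apply: Zq_mul_quot].
Qed.

(* If [h D t = k] and [h D t' = k'] then [k t' = k' t] modulo [q]; the integer
   [n = k t'] is determined by [k'], [t] and its quotient by [q], and [t']
   divides it. *)
Lemma sum_near_zero_count_sqr (d : nat) :
  (forall n, 0 < n -> n <= K * N -> tau n <= d)%N ->
  (\sum_h near_zero_count h ^ 2 <=
     K * N.+1 * ((K * N) %/ q).+1 * d * D)%N.
Proof.
move=> taud.
pose b (h : 'Z_q) (t : nat) := T t && (0 < (h * D%:R * t%:R)%R < K)%N.
have -> : (\sum_h near_zero_count h ^ 2 =
    \sum_(p : 'Z_q * ('I_N.+1 * 'I_N.+1)) (b p.1 p.2.1 && b p.1 p.2.2))%N.
  have e h : (near_zero_count h = \sum_(t < N.+1) b h t)%N.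
    by rewrite /near_zero_count big_mkcond /=; apply: eq_bigr => t _; rewrite /b; case: T.
  rewrite -(pair_big predT predT (fun h (p : 'I_N.+1 * 'I_N.+1) => (b h p.1 && b h p.2) : nat)) /=.
  apply: eq_bigr => h _; rewrite e expnS expn1 big_distrlr /= pair_big /=.
  by apply: eq_bigr => p _; rewrite mulnb.
rewrite -big_mkcond /= sum1_card.
pose n (p : 'Z_q * ('I_N.+1 * 'I_N.+1)) := ((p.1 * D%:R * p.2.1%:R)%R * p.2.2)%N.
pose f (p : 'Z_q * ('I_N.+1 * 'I_N.+1)) :=
  ((((p.1 * D%:R * p.2.2%:R)%R : nat, p.2.1 : nat, n p %/ q, index (p.2.2 : nat) (divisors (n p)))%N,
   (p.1 * D) %/ q)%N).
pose box := allpairs pair (allpairs pair (allpairs pair (allpairs pair (iota 0 K)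
  (iota 0 N.+1)) (iota 0 ((K * N) %/ q).+1)) (iota 0 d)) (iota 0 D).
have <- : size box = (K * N.+1 * ((K * N) %/ q).+1 * d * D)%N.
  by rewrite !size_allpairs !size_iota.
have nT (p : 'Z_q * ('I_N.+1 * 'I_N.+1)) : b p.1 p.2.1 && b p.1 p.2.2 ->
    [/\ (0 < n p)%N, (n p <= K * N)%N & (n p == (p.1 * D%:R * p.2.2%:R)%R * p.2.1 %[mod q])%N].
  move=> /andP[/andP[_ /andP[k0 kK]] /andP[/TN/andP[t0 _] _]]; split.
  - by rewrite muln_gt0 k0.
  - by rewrite leq_mul ?(ltnW kK) // -ltnS.
  - by rewrite -Zq_natr_eq !natrM !Zq_natr_val mulrAC.
apply: (@card_inj_seq _ _ _ f).
  move=> p p' pP pP'; have [n0 _ /eqP np] := nT _ pP; have [n0' _ /eqP np'] := nT _ pP'.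
  move: pP pP' => /andP[_ /andP[/TN/andP[t0 ct] _]] /andP[_ /andP[/TN/andP[t0' ct'] _]].
  case=> e1 e2 e3 e4 e5.
  have {}e1 : p.1 * D%:R * p.2.2%:R = p'.1 * D%:R * p'.2.2%:R by apply: val_inj.
  have {}e2 : p.2.1 = p'.2.1 by apply: val_inj.
  have en : n p = n p'.
    by rewrite (divn_eq (n p) q) (divn_eq (n p') q) e3 np np' e1 e2.
  have e6 : p.2.2 = p'.2.2.
    apply: val_inj; rewrite /= -(nth_index 0%N (_ : (p.2.2 : nat) \in divisors (n p))).
      by rewrite e4 -en nth_index // -dvdn_divisors // en dvdn_mull.
    by rewrite -dvdn_divisors // dvdn_mull.
  have e7 : p.1 = p'.1.
    apply: (Zq_mul_inj (D := D)) => //.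
    by move: e1; rewrite -e6; apply: mulIr; rewrite Zq_unit.
  by case: p p' e2 e6 e7 {n0 np e1 e3 e4 e5 t0 ct n0' np' t0' ct' en} => [h [t t']] [u [v w]] /= -> -> ->.
move=> p pP; have [n0 nK _] := nT _ pP.
move: pP => /andP[_ /andP[/TN/andP[t0 ct] /andP[_ kK]]].
have in5 : ((p.1 * D) %/ q)%N \in iota 0 D by apply: Zq_mul_quot.
have in4 : index (p.2.2 : nat) (divisors (n p)) \in iota 0 d.
  rewrite mem_iota; apply: leq_trans (taud _ n0 nK).
  by rewrite index_mem -dvdn_divisors // dvdn_mull.
have in3 : (n p %/ q)%N \in iota 0 ((K * N) %/ q).+1.
  by rewrite mem_iota /= add0n ltnS leq_div2r.
have in2 : (p.2.1 : nat) \in iota 0 N.+1 by rewrite mem_iota /= add0n.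
have in1 : ((p.1 * D%:R * p.2.2%:R)%R : nat) \in iota 0 K by rewrite mem_iota.
by do 4!apply: allpairs_f => //.
Qed.
End Fibers.

(** * Additive characters *)

Section FourierAnalysis.
Import complex.ComplexField complex.ComplexField.Normc.
Local Open Scope complex_scope.

Section Expi.
Variable R : realType.
Implicit Types (x y : R).

Definition expi (x : R) : R[i] := cos x +i* sin x.

Lemma expi0 : expi 0 = 1.
Proof. by rewrite /expi cos0 sin0. Qed.

Lemma expiD x y : expi (x + y) = expi x * expi y.
Proof.
rewrite /expi cosD sinD; apply/eqP; rewrite eq_complex /= eqxx /=.
by rewrite addrC.
Qed.

Lemma normc_expi x : normc (expi x) = 1.
Proof. by rewrite /= cos2Dsin2 sqrtr1. Qed.

Lemma expi_2pin n : expi (pi *+ 2 * n%:R) = 1.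
Proof.
elim: n => [|n IH]; first by rewrite mulr0 expi0.
by rewrite -natr1 mulrDr expiD IH mul1r mulr1 /expi cos2pi sin2pi.
Qed.

Lemma normc_real x : normc x%:C = `|x|.
Proof. by rewrite /= expr0n /= addr0 sqrtr_sqr. Qed.

Lemma ler_normc_sum (I : Type) (r : seq I) (P : pred I) (F : I -> R[i]) :
  normc (\sum_(i <- r | P i) F i) <= \sum_(i <- r | P i) normc (F i).
Proof.
elim/big_ind2: _ => [|x a y b xa yb|//]; first by rewrite normc0.
by apply: le_trans (le_normcD _ _) (lerD xa yb).
Qed.

Lemma normc_ge_Re (z : R[i]) : complex.Re z <= normc z.
Proof.
case: z => a b /=; apply: le_trans (ler_norm a) _.
by rewrite -sqrtr_sqr ler_wsqrtr // lerDl sqr_ge0.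
Qed.

Lemma normc_ge0 (z : R[i]) : 0 <= normc z.
Proof. by case: z => a b /=; exact: sqrtr_ge0. Qed.

Lemma normc_sqr (z : R[i]) : (normc z ^+ 2)%:C = z * z^*%R.
Proof.
case: z => a b; rewrite /normc sqr_sqrtr ?addr_ge0 ?sqr_ge0 //.
by apply/eqP; rewrite eq_complex /=; apply/andP; split; apply/eqP; ring.
Qed.

Lemma conjc_realM x (z : R[i]) : (x%:C * z)^*%R = x%:C * z^*%R.
Proof.
by case: z => a b; apply/eqP; rewrite eq_complex /=; apply/andP; split; apply/eqP; ring.
Qed.

Lemma real_complex_nat n : (n%:R : R)%:C = n%:R.
Proof. exact: (rmorph_nat (real_complex R) n). Qed.

Lemma normcX (z : R[i]) n : normc (z ^+ n) = normc z ^+ n.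
Proof. by elim: n => [|n IH]; rewrite ?expr0 ?normc1 // !exprS normcM IH. Qed.

Lemma normc_1BX (z : R[i]) n : normc z = 1 ->
  normc (1 - z ^+ n) <= n%:R * normc (1 - z).
Proof.
move=> z1; elim: n => [|n IH]; first by rewrite expr0 subrr normc0 mul0r.
have -> : 1 - z ^+ n.+1 = (1 - z ^+ n) + z ^+ n * (1 - z) by rewrite exprSr; ring.
apply: le_trans (le_normcD _ _) _.
by rewrite normcM normcX z1 expr1n mul1r -natr1 mulrDl mul1r lerD2r.
Qed.

End Expi.

Section AdditiveCharacter.
Variables (R : realType) (q : nat).
Hypothesis q1 : (1 < q)%N.

Definition addchar (h : 'Z_q) : R[i] := expi (pi *+ 2 * ((h : nat)%:R / q%:R)).

Lemma addchar_natr (n : nat) : addchar n%:R = expi (pi *+ 2 * (n%:R / q%:R)).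
Proof.
rewrite /addchar val_Zp_nat //.
have q0 : q%:R != 0 :> R by rewrite pnatr_eq0; lia.
have -> : n%:R / q%:R = (n %/ q)%:R + (n %% q)%:R / q%:R :> R.
  by rewrite {1}(divn_eq n q) natrD natrM; field.
by rewrite mulrDr expiD expi_2pin mul1r.
Qed.

Lemma addcharD (x y : 'Z_q) : addchar (x + y) = addchar x * addchar y.
Proof.
rewrite -{1}(natr_Zp x) -{1}(natr_Zp y) -natrD addchar_natr.
by rewrite [(_ + _)%:R]natrD [_ / q%:R]mulrDl mulrDr expiD.
Qed.

Lemma addchar0 : addchar 0 = 1.
Proof. by rewrite /addchar mul0r mulr0 expi0. Qed.

Lemma normc_addchar x : normc (addchar x) = 1.
Proof. exact: normc_expi. Qed.

Lemma addchar_mulrn x n : addchar (x *+ n) = addchar x ^+ n.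
Proof.
by elim: n => [|n IH]; rewrite ?mulr0n ?addchar0 // mulrS exprS addcharD IH.
Qed.

Lemma addcharN x : addchar (- x) = (addchar x)^*%R.
Proof.
have xN : addchar x * addchar (- x) = 1 by rewrite -addcharD subrr addchar0.
have xJ : addchar x * (addchar x)^*%R = 1.
  by rewrite -normc_sqr normc_addchar expr1n.
have : addchar x * (addchar (- x) - (addchar x)^*%R) = 0 by rewrite mulrBr xN xJ subrr.
move/eqP; rewrite mulf_eq0 => /orP[/eqP e|]; last by rewrite subr_eq0 => /eqP.
by move: xN; rewrite e mul0r => /eqP; rewrite eq_sym oner_eq0.
Qed.

(* Some multiple of [x] lies in the second quadrant, where [1 - cos >= 1]. *)
Lemma addchar_dist_half (x : 'Z_q) : (0 < (x : nat))%N -> ((x : nat).*2 <= q)%N ->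
  2 * (x : nat)%:R / q%:R <= normc (1 - addchar x).
Proof.
move=> x0 xq; set k := (x : nat) in x0 xq *.
pose m := (q %/ k.*2)%N.
have m0 : (0 < m)%N by rewrite divn_gt0 // double_gt0.
have mk : (m * k.*2 <= q)%N by apply: leq_divM.
have mk2 : (q <= 2 * (m * k.*2))%N.
  have := ltn_ceil q (_ : 0 < k.*2)%N; rewrite double_gt0 => /(_ x0).
  rewrite -/m mulSn; nia.
have q0 : 0 < q%:R :> R by rewrite ltr0n; lia.
have tel := normc_1BX m (normc_addchar x).
have far : 1 <= normc (1 - addchar x ^+ m).
  apply: le_trans (normc_ge_Re _); rewrite -addchar_mulrn -(natr_Zp x) -mulrnA.
  rewrite addchar_natr /= lerBrDr gerDl.
  set t : R := pi *+ 2 * _.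
  have mkR : (m * k.*2)%:R <= q%:R :> R by rewrite ler_nat.
  have mkR2 : q%:R <= 2 * (m * k.*2)%:R :> R by rewrite -natrM ler_nat.
  have tE : t = pi * ((m * k.*2)%:R / q%:R).
    by rewrite /t -muln2 !natrM; field; rewrite gt_eqF.
  have pi0 := pi_gt0 R.
  have t1 : t <= pi by rewrite tE ler_piMr ?(ltW pi0) // ler_pdivrMr // mul1r.
  have t2 : pi / 2 <= t.
    rewrite tE ler_wpM2l ?(ltW pi0) // ler_pdivlMr // mulrC ler_pdivrMr //.
    by rewrite mulrC.
  have -> : t = (t - pi / 2) + pi / 2 by rewrite subrK.
  rewrite cosDpihalf oppr_le0 sin_ge0_pi // subr_ge0 t2 /=.
  by rewrite lerBlDr (le_trans t1) // lerDl divr_ge0 // ltW.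
have mk3 : m%:R * (2 * k%:R) <= q%:R :> R.
  by rewrite -natrM -natrM ler_nat mul2n.
have mR : 0 < m%:R :> R by rewrite ltr0n.
rewrite ler_pdivrMr // -(ler_pM2l mR); apply: le_trans mk3 _; rewrite mulrA -[leLHS]mul1r ler_wpM2r ?(ltW q0) //.
exact: le_trans far tel.
Qed.

Lemma addchar_neq1 (x : 'Z_q) : x != 0 -> addchar x != 1.
Proof.
have key (y : 'Z_q) : (0 < (y : nat))%N -> ((y : nat).*2 <= q)%N -> addchar y != 1.
  move=> y0 /(addchar_dist_half y0) h; apply/eqP => e; move: h.
  rewrite e subrr normc0 leNgt divr_gt0 ?mulr_gt0 ?ltr0n //; lia.
move=> x0; have vx : (0 < (x : nat))%N by rewrite lt0n -[_ == 0%N](inj_eq val_inj x 0).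
have xq := Zq_lt q1 x.
case: (leqP (x : nat).*2 q) => h; first exact: key.
have e := Zq_opp_val q1 vx.
have : addchar (- x) != 1 by apply: key; rewrite e; lia.
rewrite addcharN; apply: contraNneq => ->; by rewrite rmorph1.
Qed.

Lemma sum_addchar (y : 'Z_q) : \sum_h addchar (h * y) = (q * (y == 0%R))%:R.
Proof.
have [->|y0] := eqVneq y 0.
  under eq_bigr do rewrite mulr0 addchar0.
  by rewrite sumr_const muln1 card_ord Zp_cast.
rewrite muln0; set S := (LHS).
have : S * (addchar y - 1) = 0.
  rewrite mulrBr mulr1 {2}/S (reindex_inj (addIr 1)) /= mulr_suml -sumrB.
  by rewrite big1 // => h _; rewrite mulrDl mul1r addcharD subrr.
by move/eqP; rewrite mulf_eq0 subr_eq0 (negPf (addchar_neq1 y0)) orbF => /eqP.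
Qed.

Lemma addchar_parseval (I : finType) (A : pred I) (F : I -> R) (w : I -> 'Z_q) :
  (forall i, `|F i| <= 1) ->
  \sum_h normc (\sum_(i | A i) (F i)%:C * addchar (h * w i)) ^+ 2 <=
  (q * \sum_(i | A i) \sum_(j | A j) (w i == w j))%:R.
Proof.
move=> F1.
have -> : \sum_h normc (\sum_(i | A i) (F i)%:C * addchar (h * w i)) ^+ 2 =
    \sum_(i | A i) \sum_(j | A j) F i * F j * (q * (w i == w j))%:R.
  apply: complexI; rewrite rmorph_sum /=.
  under eq_bigr => h _.
    rewrite normc_sqr rmorph_sum /= big_distrlr /=.
    under eq_bigr => i _.
      under eq_bigr => j _.
        rewrite conjc_realM mulrACA -addcharN -addcharD -mulrBr -rmorphM /=.
        over.
      over.
    over.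
  rewrite exchange_big rmorph_sum; apply: eq_bigr => i _ /=.
  rewrite exchange_big rmorph_sum; apply: eq_bigr => j _ /=.
  by rewrite -mulr_sumr sum_addchar subr_eq0 -real_complex_nat -[LHS](rmorphM (real_complex R)).
rewrite big_distrr natr_sum /=; apply: ler_sum => i _.
rewrite big_distrr natr_sum /=; apply: ler_sum => j _.
rewrite -[leRHS]mul1r ler_wpM2r //; apply: le_trans (ler_norm _) _.
by rewrite normrM -[leRHS]mulr1 ler_pM.
Qed.

Lemma fourth_moment (N : nat) (T : pred nat) (f : nat -> R) :
  (forall t, `|f t| <= 1) -> (forall t, T t -> (0 < t)%N && coprime t q) ->
  \sum_h normc (\sum_(t < N.+1 | T t) (f t)%:C * addchar (h * (t%:R)^-1)) ^+ 4 <=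
  (q * inverse_energy N q)%:R.
Proof.
move=> f1 TN.
have T0 : T 0%N = false by apply/negP => /TN.
pose A (i : 'I_N * 'I_N) := T i.1.+1 && T i.2.+1.
pose w (i : 'I_N * 'I_N) : 'Z_q := (i.1.+1%:R)^-1 + (i.2.+1%:R)^-1.
have -> : \sum_h normc (\sum_(t < N.+1 | T t) (f t)%:C * addchar (h * (t%:R)^-1)) ^+ 4 =
  \sum_h normc (\sum_(i | A i) (f i.1.+1 * f i.2.+1)%:C * addchar (h * w i)) ^+ 2.
  apply: eq_bigr => h _; rewrite big_mkcond big_ord_recl /= T0 add0r.
  under eq_bigr do rewrite /bump add1n.
  rewrite -big_mkcond /= -[4%N]/(2 * 2)%N exprM -normcX.
  congr (normc _ ^+ 2); rewrite expr2 big_distrlr /= pair_big /=; apply: eq_bigr => i _.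
  by rewrite mulrACA -rmorphM -addcharD -mulrDr.
apply: le_trans (addchar_parseval _ _ _) _.
  by move=> i; rewrite normrM -[leRHS]mulr1 ler_pM.
rewrite ler_nat leq_mul2l /inverse_energy; apply/orP; right.
rewrite big_mkcond /=; apply: leq_sum => k _; case: ifP => // /andP[/TN/andP[_ k1] /TN/andP[_ k2]].
rewrite big_mkcond /=; apply: leq_sum => i _; case: ifP => // /andP[/TN/andP[_ i1] /TN/andP[_ i2]].
case: eqP => // e; rewrite -Zq_natr_eq // !natrM !natrD.
move: k1 k2 i1 i2 e; rewrite /w -!(Zq_unit q1).
set a := k.1.+1%:R; set b := k.2.+1%:R; set c := i.1.+1%:R; set d := i.2.+1%:R.
move=> ua ub uc ud e.
have e1 : (a^-1 + b^-1) * (a * b) = a + b.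
  by rewrite mulrDl mulKr // [a * b]mulrC mulKr // addrC.
have e2 : (c^-1 + d^-1) * (c * d) = c + d.
  by rewrite mulrDl mulKr // [c * d]mulrC mulKr // addrC.
by rewrite -e1 -e2 e lt0b; apply/eqP; ring.
Qed.
End AdditiveCharacter.

Section CauchySchwarz.
Variables (R : realType) (I : finType).

Lemma weighted_cauchy (w x y : I -> R) : (forall i, 0 <= w i) ->
  (\sum_i w i * x i * y i) ^+ 2 <= (\sum_i w i * x i ^+ 2) * (\sum_i w i * y i ^+ 2).
Proof.
move=> w0; rewrite -subr_ge0.
have <- : (\sum_i \sum_j w i * w j * (x i * y j - x j * y i) ^+ 2) / 2 =
  (\sum_i w i * x i ^+ 2) * (\sum_i w i * y i ^+ 2) - (\sum_i w i * x i * y i) ^+ 2.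
  have e1 : (\sum_i w i * x i ^+ 2) * (\sum_i w i * y i ^+ 2) =
      \sum_i \sum_j w i * w j * (x i ^+ 2 * y j ^+ 2).
    rewrite big_distrlr /=; apply: eq_bigr => i _; apply: eq_bigr => j _; ring.
  have e2 : (\sum_i w i * x i ^+ 2) * (\sum_i w i * y i ^+ 2) =
      \sum_i \sum_j w i * w j * (x j ^+ 2 * y i ^+ 2).
    rewrite e1 exchange_big /=; apply: eq_bigr => i _; apply: eq_bigr => j _; ring.
  have e3 : (\sum_i w i * x i * y i) ^+ 2 =
      \sum_i \sum_j w i * w j * (x i * y i * x j * y j).
    rewrite expr2 big_distrlr /=; apply: eq_bigr => i _; apply: eq_bigr => j _; ring.
  have : \sum_i \sum_j w i * w j * (x i * y j - x j * y i) ^+ 2 =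
    \sum_i \sum_j w i * w j * (x i ^+ 2 * y j ^+ 2) +
    \sum_i \sum_j w i * w j * (x j ^+ 2 * y i ^+ 2) -
    (\sum_i \sum_j w i * w j * (x i * y i * x j * y j)) *+ 2.
    rewrite -big_split /= -sumrMnl -sumrB; apply: eq_bigr => i _.
    rewrite -big_split /= -sumrMnl -sumrB; apply: eq_bigr => j _; ring.
  by rewrite -e1 -e2 -e3 => ->; field.
rewrite divr_ge0 // sumr_ge0 // => i _; rewrite sumr_ge0 // => j _.
by rewrite mulr_ge0 ?sqr_ge0 // mulr_ge0.
Qed.

Lemma hoelder4 (nu p : I -> R) : (forall i, 0 <= nu i) ->
  (\sum_i nu i * p i) ^+ 4 <=
  (\sum_i nu i) ^+ 2 * (\sum_i nu i ^+ 2) * (\sum_i p i ^+ 4).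
Proof.
move=> nu0.
have h1 : (\sum_i nu i * p i) ^+ 2 <= (\sum_i nu i) * (\sum_i nu i * p i ^+ 2).
  have := weighted_cauchy (fun=> 1) p nu0.
  under eq_bigr do rewrite mulr1; under [X in _ <= X * _ -> _]eq_bigr do rewrite expr1n mulr1.
  by [].
have h2 : (\sum_i nu i * p i ^+ 2) ^+ 2 <= (\sum_i nu i ^+ 2) * (\sum_i p i ^+ 4).
  have := @weighted_cauchy (fun=> 1) nu (fun i => p i ^+ 2) (fun=> ler01).
  under eq_bigr do rewrite mul1r; under [X in _ <= X * _ -> _]eq_bigr do rewrite mul1r.
  by under [X in _ <= _ * X -> _]eq_bigr do rewrite mul1r -exprM.
rewrite -[4%N]/(2 * 2)%N !exprM.
apply: le_trans (_ : ((\sum_i nu i) * (\sum_i nu i * p i ^+ 2)) ^+ 2 <= _).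
  by rewrite lerXn2r // ?nnegrE ?sqr_ge0 // mulr_ge0 // sumr_ge0 // => i _; rewrite mulr_ge0 ?sqr_ge0.
by rewrite exprMn -mulrA ler_wpM2l ?sqr_ge0.
Qed.
End CauchySchwarz.

(** * Fourier expansion *)

Section PeriodicSums.
Variables (R : realType) (D : nat).
Hypothesis D0 : (0 < D)%N.

Lemma ler_normc_sum_nat (G : nat -> R[i]) (m n : nat) :
  (forall t, normc (G t) <= 1) -> normc (\sum_(m <= t < n) G t) <= (n - m)%:R.
Proof.
move=> G1; apply: le_trans (ler_normc_sum _ _ _) _.
apply: le_trans (_ : \sum_(m <= t < n) 1 <= _); first exact: ler_sum.
by rewrite sumr_const_nat.
Qed.

Lemma periodic_sum_bound (G : nat -> R[i]) (n : nat) :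
  (forall t, G (D + t)%N = G t) -> (forall t, normc (G t) <= 1) ->
  \sum_(0 <= t < D) G t = 0 -> normc (\sum_(0 <= t < n) G t) <= D%:R.
Proof.
move=> GD G1 G0; elim/ltn_ind: n => n IH; case: (leqP n D) => nD.
  apply: le_trans (ler_normc_sum_nat _ _ G1) _.
  by rewrite ler_nat subn0.
rewrite (big_cat_nat (n := D)) ?(ltnW nD) //= G0 add0r -{1}(add0n D) big_addn.
by under eq_bigr do rewrite addnC GD; apply: IH; lia.
Qed.

Lemma periodic_power_sum (F : nat -> R) (z : R[i]) (m n : nat) : (m <= n)%N ->
  (forall t, F (D + t)%N = F t) -> (forall t, `|F t| <= 1) -> normc z = 1 ->
  normc (1 - z ^+ D) * normc (\sum_(m <= t < n) (F t)%:C * z ^+ t) <= 2 * D%:R.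
Proof.
move=> mn FD F1 z1; pose G t := (F t)%:C * z ^+ t.
have G1 t : normc (G t) <= 1 by rewrite normcM normcX z1 expr1n mulr1 normc_real.
rewrite -normcM mulrBl mul1r mulr_sumr.
have -> : \sum_(m <= t < n) z ^+ D * ((F t)%:C * z ^+ t) = \sum_(m + D <= t < n + D) G t.
  rewrite big_addn addnK; apply: eq_bigr => t _.
  by rewrite /G addnC FD exprD; ring.
have e : \sum_(m <= t < n) G t + \sum_(n <= t < n + D) G t =
    \sum_(m <= t < m + D) G t + \sum_(m + D <= t < n + D) G t.
  by rewrite -!big_cat_nat //=; lia.
have -> : \sum_(m <= t < n) G t - \sum_(m + D <= t < n + D) G t =
    \sum_(m <= t < m + D) G t - \sum_(n <= t < n + D) G t.
  by apply/eqP; rewrite subr_eq addrAC -e addrK.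
apply: le_trans (le_normcD _ _) _; rewrite normcN mulr_natl mulr2n lerD //.
  by have := ler_normc_sum_nat m (m + D) G1; rewrite addKn.
by have := ler_normc_sum_nat n (n + D) G1; rewrite addKn.
Qed.
End PeriodicSums.

Lemma dyadic_moment_le (R : realFieldType) (c k A B D M Q d J F : R) :
  0 <= c -> 0 <= k -> 0 <= B -> B <= A -> 1 <= D -> 0 <= M -> 0 <= Q -> 0 <= d ->
  0 <= J -> c <= A -> c * k <= D * Q -> Q * F <= 2 * k * B + Q ->
  c ^+ 4 * ((M * (2 * k * D)) ^+ 2 * (2 * k * M * F * d * D) * (Q * J)) <=
  Q ^+ 4 * (24 * (D ^+ 7 * M ^+ 3 * A * d * J)).
Proof.
move=> c0 k0 B0 BA D1 M0 Q0 d0 J0 cA ck quot.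
have D0 : 0 <= D by apply: le_trans D1.
have A0 : 0 <= A by apply: le_trans BA.
have ck0 : 0 <= c * k by rewrite mulr_ge0.
have DQ0 : 0 <= D * Q by rewrite mulr_ge0.
have e3 : c * (c * k) ^+ 3 <= A * (D * Q) ^+ 3.
  by rewrite ler_pM ?exprn_ge0 // lerXn2r ?nnegrE.
have e4 : (c * k) ^+ 4 <= (D * Q) ^+ 4 by rewrite lerXn2r ?nnegrE.
have -> : c ^+ 4 * ((M * (2 * k * D)) ^+ 2 * (2 * k * M * F * d * D) * (Q * J)) =
  8 * M ^+ 3 * D ^+ 3 * d * J * (c * (c * k) ^+ 3 * (Q * F)) by ring.
have -> : Q ^+ 4 * (24 * (D ^+ 7 * M ^+ 3 * A * d * J)) =
  8 * M ^+ 3 * D ^+ 3 * d * J * (3 * A * D ^+ 4 * Q ^+ 4) by ring.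
rewrite ler_wpM2l ?mulr_ge0 ?exprn_ge0 //.
apply: le_trans (_ : c * (c * k) ^+ 3 * (2 * k * B + Q) <= _).
  by rewrite ler_wpM2l // mulr_ge0 ?exprn_ge0.
have -> : c * (c * k) ^+ 3 * (2 * k * B + Q) = 2 * B * (c * k) ^+ 4 + Q * (c * (c * k) ^+ 3).
  by ring.
apply: le_trans (_ : 2 * A * (D * Q) ^+ 4 + Q * (A * (D * Q) ^+ 3) <= _).
  apply: lerD; last by rewrite ler_wpM2l.
  by rewrite ler_pM ?mulr_ge0 ?exprn_ge0 // ler_wpM2l.
have -> : 3 * A * D ^+ 4 * Q ^+ 4 = 2 * A * (D * Q) ^+ 4 + A * D ^+ 3 * Q ^+ 4 * D.
  by ring.
rewrite lerD2l; have -> : Q * (A * (D * Q) ^+ 3) = A * D ^+ 3 * Q ^+ 4 * 1 by ring.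
by rewrite ler_wpM2l // !mulr_ge0 ?exprn_ge0.
Qed.

Section Ternary.
Variables (R : realType) (q D : nat).
Hypotheses (q1 : (1 < q)%N) (D0 : (0 < D)%N).
Variables (m1 n1 N1 N2 N3 : nat) (T2 T3 : pred nat) (f1 f2 f3 : nat -> R).
Hypotheses (le_m1n1 : (m1 <= n1)%N) (le_N1 : (n1 - m1 <= N1)%N) (le_N31 : (N3 <= N1)%N).
Hypotheses (T2P : forall t, T2 t -> (0 < t)%N && coprime t q)
           (T3P : forall t, T3 t -> (0 < t)%N && coprime t q).
Hypotheses (f1_le1 : forall t, `|f1 t| <= 1) (f2_le1 : forall t, `|f2 t| <= 1)
           (f3_le1 : forall t, `|f3 t| <= 1).
Hypothesis f1_periodic : forall t, f1 (D + t)%N = f1 t.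
Variable a : 'Z_q.
Hypothesis a_unit : a \is a GRing.unit.

Definition congruence_sum : R :=
  \sum_(t3 < N3.+1 | T3 t3) \sum_(t2 < N2.+1 | T2 t2) \sum_(m1 <= t1 < n1)
    f1 t1 * f2 t2 * f3 t3 * ((t1%:R * t2%:R * t3%:R == a) : nat)%:R.

Definition long_sum (h : 'Z_q) : R[i] :=
  \sum_(m1 <= t < n1) (f1 t)%:C * addchar R h ^+ t.

Definition inverse_sum (h : 'Z_q) : R[i] :=
  \sum_(t < N2.+1 | T2 t) (f2 t)%:C * addchar R (h * - a * (t%:R)^-1).

Definition frequency_term (h : 'Z_q) : R[i] :=
  \sum_(t < N3.+1 | T3 t) (f3 t)%:C * long_sum (h * t%:R) * inverse_sum h.

Lemma congruence_sum_fourier :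
  (q%:R * congruence_sum)%:C = \sum_h frequency_term h.
Proof.
have -> : \sum_h frequency_term h =
    \sum_(t3 < N3.+1 | T3 t3) \sum_(t2 < N2.+1 | T2 t2) \sum_(m1 <= t1 < n1)
    (f1 t1 * f2 t2 * f3 t3)%:C *
      \sum_h addchar R (h * (t1%:R * t3%:R - a * (t2%:R)^-1)).
  rewrite /frequency_term exchange_big /=; apply: eq_bigr => t3 _.
  rewrite (eq_bigr (fun h => \sum_(t2 < N2.+1 | T2 t2) \sum_(m1 <= t1 < n1)
    (f1 t1 * f2 t2 * f3 t3)%:C * addchar R (h * (t1%:R * t3%:R - a * (t2%:R)^-1)))).
    rewrite exchange_big /=; apply: eq_bigr => t2 _.
    by rewrite exchange_big /=; apply: eq_bigr => t1 _; rewrite mulr_sumr.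
  move=> h _; rewrite /inverse_sum mulr_sumr; apply: eq_bigr => t2 _.
  rewrite /long_sum mulr_sumr mulr_suml; apply: eq_bigr => t1 _.
  rewrite -addchar_mulrn // -[(h * t3%:R) *+ t1]mulr_natr !rmorphM /=.
  rewrite mulrBr addcharD //.
  have -> : h * (t1%:R * t3%:R) = h * t3%:R * t1%:R by rewrite mulrCA mulrC.
  have -> : - (h * (a / t2%:R)) = h * - a / t2%:R by rewrite mulrN mulrA mulNr.
  ring.
rewrite /congruence_sum mulr_sumr rmorph_sum /=; apply: eq_bigr => t3 /T3P/andP[_ c3].
rewrite mulr_sumr rmorph_sum /=; apply: eq_bigr => t2 /T2P/andP[_ c2].
rewrite mulr_sumr rmorph_sum /=; apply: eq_bigr => t1 _.
rewrite sum_addchar // -real_complex_nat -[RHS](rmorphM (real_complex R)).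
congr _%:C; rewrite natrM.
have -> : (t1%:R * t3%:R - a / t2%:R == 0) = (t1%:R * t2%:R * t3%:R == a :> 'Z_q).
  have u2 : (t2%:R : 'Z_q) \is a GRing.unit by rewrite Zq_unit.
  by rewrite subr_eq0 -(inj_eq (mulIr u2)) divrK // mulrAC.
ring.
Qed.

Variables (d : nat) (w : R).
Let J := inverse_energy N2 q.
Hypothesis taud : forall n, (0 < n)%N -> (n <= q.*2 * N3)%N -> (tau n <= d)%N.
Hypotheses (w0 : 0 <= w)
  (w4 : 24 * (D ^ 7 * N3.+1 ^ 3 * N1 * d * J)%:R <= w ^+ 4).

Definition dyadic_weight (j : nat) : R :=
  Num.min N1%:R (D%:R * q%:R / (2 ^ j)%:R).

Let L := (trunc_log 2 q).+1.
Let q0 : 0 < q%:R :> R.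
Proof. by rewrite ltr0n; lia. Qed.

Lemma dyadic_weight_ge0 j : 0 <= dyadic_weight j.
Proof. by rewrite le_min ler0n divr_ge0 ?mulr_ge0. Qed.

Lemma long_sum_bound (h : 'Z_q) : h * D%:R != 0 ->
  normc (long_sum h) <= \sum_(j < L) dyadic_weight j *
    ((0 < (h * D%:R)%R < 2 ^ j.+1) + (0 < (- (h * D%:R))%R < 2 ^ j.+1))%N%:R.
Proof.
move=> x0; set x := h * D%:R in x0 *.
have G1 t : normc ((f1 t)%:C * addchar R h ^+ t) <= 1.
  by rewrite normcM normcX normc_addchar expr1n mulr1 normc_real.
have trivial_bound : normc (long_sum h) <= N1%:R.
  by apply: le_trans (ler_normc_sum_nat _ _ G1) _; rewrite ler_nat.
have geom : normc (1 - addchar R x) * normc (long_sum h) <= 2 * D%:R.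
  have := periodic_power_sum D0 le_m1n1 f1_periodic f1_le1 (normc_addchar R h).
  by rewrite -addchar_mulrn // -[h *+ D]mulr_natr.
have one (y : 'Z_q) : (0 < (y : nat))%N -> ((y : nat).*2 <= q)%N ->
    normc (1 - addchar R y) * normc (long_sum h) <= 2 * D%:R ->
    exists2 j : 'I_L, (0 < (y : nat) < 2 ^ j.+1)%N & normc (long_sum h) <= dyadic_weight j.
  move=> y0 yq gy; set k := (y : nat) in y0 yq *.
  have jL : (trunc_log 2 k < L)%N by rewrite ltnS leq_trunc_log //; lia.
  have /andP[jk kj] := trunc_log_bounds (isT : 1 < 2)%N y0.
  exists (Ordinal jL); first by rewrite y0.
  rewrite /dyadic_weight le_min trivial_bound /=.
  have k0 : 0 < k%:R :> R by rewrite ltr0n.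
  apply: le_trans (_ : D%:R * q%:R / k%:R <= _); last first.
    by rewrite ler_wpM2l ?mulr_ge0 // lef_pV2 ?posrE ?ltr0n ?expn_gt0 // ler_nat.
  have hh := addchar_dist_half R q1 y0 yq.
  rewrite ler_pdivlMr // -(ler_pM2l (ltr0n R 2)) mulrA (mulrA 2 D%:R).
  rewrite -ler_pdivrMr //.
  apply: le_trans gy; have -> : 2 * normc (long_sum h) * k%:R / q%:R =
    (2 * k%:R / q%:R) * normc (long_sum h) by ring.
  by rewrite ler_wpM2r ?normc_ge0.
have fin (j : 'I_L) (b : nat) : (0 < b)%N -> normc (long_sum h) <= dyadic_weight j ->
   normc (long_sum h) <= dyadic_weight j * b%:R.
  move=> b0 hj; apply: le_trans hj _; rewrite ler_peMr ?dyadic_weight_ge0 //.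
  by rewrite ler1n.
have gN : normc (1 - addchar R (- x)) = normc (1 - addchar R x).
  have -> : 1 - addchar R (- x) = - addchar R (- x) * (1 - addchar R x).
    by rewrite mulrBr mulr1 mulNr opprK -addcharD // addNr addchar0 addrC.
  by rewrite normcM normcN normc_addchar mul1r.
have vx : (0 < (x : nat))%N by rewrite lt0n -[_ == 0%N](inj_eq val_inj x 0).
have [j hb hj] : exists2 j : 'I_L,
    (0 < (0 < (x : nat) < 2 ^ j.+1) + (0 < ((- x : 'Z_q) : nat) < 2 ^ j.+1))%N &
    normc (long_sum h) <= dyadic_weight j.
  case: (leqP (x : nat).*2 q) => h2.
    have [j bj hj] := one x vx h2 geom; exists j => //.
    by rewrite addn_gt0; apply/orP; left; rewrite lt0b; exact: bj.
  have xq := Zq_lt q1 x.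
  have e := Zq_opp_val q1 vx.
  have y0 : (0 < ((- x)%R : nat))%N by rewrite e subn_gt0.
  have y2 : (((- x)%R : nat).*2 <= q)%N by rewrite e; lia.
  have gy : normc (1 - addchar R (- x)) * normc (long_sum h) <= 2 * D%:R by rewrite gN.
  have [j bj hj] := one (- x) y0 y2 gy.
  by exists j => //; rewrite addn_gt0; apply/orP; right; rewrite lt0b; exact: bj.
rewrite (bigD1 j) //=; apply: le_trans (fin j _ hb hj) _; rewrite lerDl.
by apply: sumr_ge0 => i _; rewrite mulr_ge0 ?dyadic_weight_ge0.
Qed.

Lemma near_moment (j : nat) (p : 'Z_q -> R) : (j < L)%N -> (forall h, 0 <= p h) ->
  \sum_h p h ^+ 4 <= (q * J)%:R ->
  dyadic_weight j * \sum_h (near_zero_count N3 D (2 ^ j.+1) T3 h)%:R * p h <= q%:R * w.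
Proof.
move=> jL p0 p4; have c0 := dyadic_weight_ge0 j.
set c := dyadic_weight j in c0 *; set nu := near_zero_count _ _ _ _; set K := (2 ^ j.+1)%N.
have jq : (2 ^ j <= q)%N.
  by apply: leq_trans (_ : 2 ^ trunc_log 2 q <= _)%N; rewrite ?leq_pexp2l ?trunc_logP //; lia.
have S1 : \sum_h (nu h)%:R <= (N3.+1 * (K * D))%:R :> R.
  by rewrite -natr_sum ler_nat sum_near_zero_count.
have S2 : \sum_h (nu h)%:R ^+ 2 <= (K * N3.+1 * ((K * N3) %/ q).+1 * d * D)%:R :> R.
  under eq_bigr do rewrite -natrX.
  rewrite -natr_sum ler_nat sum_near_zero_count_sqr // => n n0 nK.
  apply: taud => //; apply: leq_trans nK _; rewrite leq_mul2r /K expnS mul2n leq_double jq.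
  by rewrite orbT.
have nn0 : 0 <= \sum_h (nu h)%:R * p h by rewrite sumr_ge0 // => h _; rewrite mulr_ge0.
rewrite -(@ler_pXn2r _ 4) ?nnegrE ?mulr_ge0 // ?(ltW q0) // !exprMn.
pose k : R := (2 ^ j)%:R.
have k0 : 0 < k by rewrite ltr0n expn_gt0.
have ck : c * k <= D%:R * q%:R by rewrite -ler_pdivlMr // ge_min lexx orbT.
have cN : c <= N1%:R by rewrite ge_min lexx.
have quot : q%:R * ((K * N3) %/ q).+1%:R <= 2 * k * N3%:R + q%:R :> R.
  rewrite -natr1 mulrDr mulr1 lerD2r -!natrM ler_nat mulnC -expnS.
  exact: leq_divM.
have KE : K%:R = 2 * k by rewrite /K expnS natrM.
apply: le_trans (_ : c ^+ 4 * ((N3.+1 * (K * D))%:R ^+ 2 *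
   (K * N3.+1 * ((K * N3) %/ q).+1 * d * D)%:R * (q * J)%:R) <= _).
  rewrite ler_wpM2l ?exprn_ge0 //.
  apply: le_trans (hoelder4 _ _) _ => //.
  have nu0 : 0 <= \sum_h (nu h)%:R :> R by rewrite sumr_ge0.
  have nu2 : 0 <= \sum_h (nu h)%:R ^+ 2 :> R by rewrite sumr_ge0 // => h _; rewrite sqr_ge0.
  have p40 : 0 <= \sum_h p h ^+ 4 by rewrite sumr_ge0 // => h _; rewrite exprn_ge0.
  have S1' : (\sum_h (nu h)%:R) ^+ 2 <= (N3.+1 * (K * D))%:R ^+ 2 :> R.
    by rewrite lerXn2r ?nnegrE.
  apply: ler_pM => //; first by rewrite mulr_ge0 ?sqr_ge0.
  exact: ler_pM (sqr_ge0 _) nu2 S1' S2.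
apply: le_trans (_ : q%:R ^+ 4 * (24 * (D ^ 7 * N3.+1 ^ 3 * N1 * d * J)%:R) <= _); last first.
  by rewrite ler_wpM2l ?exprn_ge0 ?(ltW q0).
have -> : (D ^ 7 * N3.+1 ^ 3 * N1 * d * J)%:R =
    D%:R ^+ 7 * N3.+1%:R ^+ 3 * N1%:R * d%:R * J%:R :> R.
  by rewrite -!natrX -!natrM.
rewrite !natrM KE.
have BA : N3%:R <= N1%:R :> R by rewrite ler_nat.
have D1 : 1 <= D%:R :> R by rewrite ler1n.
exact: (dyadic_moment_le c0 (ltW k0) (ler0n _ _) BA D1 (ler0n _ _) (ltW q0)
  (ler0n _ _) (ler0n _ _) cN ck quot).
Qed.

Lemma inverse_sum_moment (s : 'Z_q) : s \is a GRing.unit ->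
  \sum_h normc (inverse_sum (h * s)) ^+ 4 <= (q * J)%:R.
Proof.
move=> us; have us' : s * - a \is a GRing.unit by rewrite unitrM us unitrN.
apply: le_trans (fourth_moment q1 _ f2_le1 T2P).
rewrite [leRHS](reindex_inj (mulIr us')) /= le_eqVlt; apply/orP; left; apply/eqP.
apply: eq_bigr => h _; congr (normc _ ^+ 4); apply: eq_bigr => t _.
by rewrite mulrA.
Qed.

Lemma frequency_error :
  normc (\sum_(h | h * D%:R != 0) frequency_term h) <= q%:R * (2 * L%:R * w).
Proof.
pose near (j : nat) (h : 'Z_q) : R := (near_zero_count N3 D (2 ^ j.+1) T3 h)%:R.
pose p (h : 'Z_q) : R := normc (inverse_sum h).
apply: le_trans (_ : \sum_h \sum_(j < L) dyadic_weight j * (near j h + near j (- h)) * p h <= _).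
  apply: le_trans (ler_normc_sum _ _ _) _.
  rewrite big_mkcond /=; apply: ler_sum => h _.
  have nn : 0 <= \sum_(j < L) dyadic_weight j * (near j h + near j (- h)) * p h.
    apply: sumr_ge0 => j _; rewrite mulr_ge0 ?normc_ge0 // mulr_ge0 ?dyadic_weight_ge0 //.
    by rewrite addr_ge0.
  case: ifP => // hD; apply: le_trans (ler_normc_sum _ _ _) _.
  rewrite -mulr_suml.
  apply: le_trans (_ : \sum_(t < N3.+1 | T3 t) normc (long_sum (h * t%:R)) * p h <= _).
    apply: ler_sum => t _; rewrite !normcM normc_real ler_wpM2r ?normc_ge0 //.
    by rewrite ler_piMl ?normc_ge0.
  rewrite -mulr_suml ler_wpM2r ?normc_ge0 //.
  apply: le_trans (_ : \sum_(t < N3.+1 | T3 t) \sum_(j < L) dyadic_weight j *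
    ((0 < (h * D%:R * t%:R)%R < 2 ^ j.+1) + (0 < (- h * D%:R * t%:R)%R < 2 ^ j.+1))%N%:R <= _).
    apply: ler_sum => t /T3P/andP[_ ct].
    have ut : (t%:R : 'Z_q) \is a GRing.unit by rewrite Zq_unit.
    have := @long_sum_bound (h * t%:R); rewrite mulrAC !mulNr; apply.
    by rewrite -(mul0r t%:R) (inj_eq (mulIr ut)).
  rewrite exchange_big /=; apply: ler_sum => j _.
  rewrite -mulr_sumr ler_wpM2l ?dyadic_weight_ge0 //.
  by rewrite /near /near_zero_count -natrD -big_split /= natr_sum.
rewrite exchange_big /=.
apply: le_trans (_ : \sum_(j < L) (q%:R * w + q%:R * w) <= _); last first.
  rewrite sumr_const card_ord -mulr_natr le_eqVlt; apply/orP; left; apply/eqP; ring.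
apply: ler_sum => j _.
under eq_bigr => h _ do rewrite -mulrA mulrDl mulrDr.
rewrite big_split /= -!mulr_sumr lerD //.
  apply: near_moment => // [h|]; first exact: normc_ge0.
  by have := inverse_sum_moment (unitr1 _); under eq_bigr do rewrite mulr1.
rewrite (reindex_inj oppr_inj) /=; under eq_bigr do rewrite opprK.
apply: near_moment => // [h|]; first exact: normc_ge0.
by have := inverse_sum_moment (unitrN1 _); under eq_bigr do rewrite mulrN1.
Qed.

Lemma congruence_sum_bound :
  q%:R * `|congruence_sum| <=
  normc (\sum_(h | h * D%:R == 0) frequency_term h) + q%:R * (2 * L%:R * w).
Proof.
have -> : q%:R * `|congruence_sum| = normc (\sum_h frequency_term h).
  by rewrite -congruence_sum_fourier normc_real normrM normr_nat.
rewrite (bigID (fun h => h * D%:R == 0)) /=.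
by apply: le_trans (le_normcD _ _) _; rewrite lerD2l frequency_error.
Qed.

End Ternary.

(** * Zero frequencies *)

Lemma coprime_mul_sum0 (R : realType) (D n : nat) (c : R[i]) (G : nat -> R[i]) :
  (0 < D)%N -> coprime n D -> (forall t, G (t %% D)%N = G t) ->
  (forall t, G (n * t)%N = c * G t) -> c != 1 -> \sum_(0 <= t < D) G t = 0.
Proof.
move=> D0 cn Gmod Gn c1.
pose s (t : 'I_D) : 'I_D := Ordinal (ltn_pmod (n * t) D0).
have sI : injective s.
  have key (t t' : 'I_D) : (t <= t')%N -> s t = s t' -> t = t'.
    move=> tt' [] /esym/eqP; rewrite eqn_mod_dvd ?leq_mul2l ?tt' ?orbT // -mulnBr.
    rewrite Gauss_dvdr 1?coprime_sym // => /dvdn_leq h; apply: val_inj => /=.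
    have := ltn_ord t'; have := h; lia.
  move=> t t' e; case: (leqP t t') => [|/ltnW] tt'; first exact: key.
  by apply/esym/key.
rewrite big_mkord; set S := (LHS).
have : (1 - c) * S = 0.
  rewrite mulrBl mul1r {1}/S (reindex_inj sI) /= /S mulr_sumr -sumrB big1 // => t _.
  by rewrite Gmod Gn subrr.
by move/eqP; rewrite mulf_eq0 subr_eq0 eq_sym (negPf c1) => /eqP.
Qed.

Section Character.
Variables (R : realType) (D : nat) (chi : int -> R).
Hypotheses (chiD : dirichlet_character D chi) (chi_quad : quadratic_character D chi).

Lemma dirichlet_le1 n : `|chi n| <= 1.
Proof.
have [cn|] := boolP (coprimez n D).
  have := chi_quad.1 n cn => /eqP; rewrite sqrf_eq1 => /orP[]/eqP->.
    by rewrite normr1.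
  by rewrite normrN1.
by rewrite -(dirichlet_support chiD) negbK => /eqP ->; rewrite normr0.
Qed.

Lemma dirichlet_modn (t : nat) : chi (t %% D)%N%:Z = chi t%:Z.
Proof. by apply: (dirichlet_periodic chiD); rewrite -modz_nat modz_mod. Qed.

Lemma dirichlet_addn (t : nat) : chi (D + t)%N%:Z = chi t%:Z.
Proof. by rewrite -dirichlet_modn modnDl dirichlet_modn. Qed.

Lemma dirichlet_muln (m n : nat) : chi (m * n)%N%:Z = chi m%:Z * chi n%:Z.
Proof. by rewrite PoszM (dirichlet_mul chiD). Qed.

Lemma dirichlet_natrep (n : int) : coprimez n D ->
  exists2 m : nat, coprime m D & chi m%:Z = chi n /\ (m%:Z = n %[mod D])%Z.
Proof.
move=> cn; have D0 := dirichlet_modulus_gt0 chiD.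
have e : (`|(n %% D)%Z|%N)%:Z = (n %% D)%Z by rewrite gez0_abs // modz_ge0 // lt0n_neq0.
have em : ((`|(n %% D)%Z|%N)%:Z = n %[mod D])%Z by rewrite e modz_mod.
have ec : chi (`|(n %% D)%Z|%N)%:Z = chi n by apply: (dirichlet_periodic chiD).
exists `|(n %% D)%Z|%N => //.
by have := cn; rewrite -(dirichlet_support chiD) -ec (dirichlet_support chiD) coprimezE.
Qed.

Lemma dirichlet_sum0 : \sum_(0 <= t < D) (chi t%:Z)%:C = 0.
Proof.
have [n cn n1] := chi_quad.2; have [m cm [em _]] := dirichlet_natrep cn.
apply: (coprime_mul_sum0 (c := (chi n)%:C) (dirichlet_modulus_gt0 chiD) cm).
- by move=> t; rewrite dirichlet_modn.
- by move=> t; rewrite dirichlet_muln em -[RHS](rmorphM (real_complex R)).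
- by apply: contraNneq n1 => -[] ->.
Qed.

Lemma dirichlet_prefix_sum n : `|\sum_(t < n) chi t.+1%:Z| <= D%:R.
Proof.
have D0 := dirichlet_modulus_gt0 chiD.
rewrite -normc_real rmorph_sum /= -(big_mkord predT (fun t => (chi t.+1%:Z)%:C)).
apply: (@periodic_sum_bound _ _ D0 (fun t => (chi t.+1%:Z)%:C)) => //.
- by move=> t; rewrite -addnS dirichlet_addn.
- by move=> t; rewrite normc_real dirichlet_le1.
apply: (addrI (chi 0%:Z)%:C); rewrite addr0.
have -> : (chi 0%:Z)%:C + \sum_(0 <= t < D) (chi t.+1%:Z)%:C =
    \sum_(0 <= t < D.+1) (chi t%:Z)%:C by rewrite big_nat_recl.
by rewrite big_nat_recr //= dirichlet_sum0 add0r -[in chi D%:Z](addn0 D) dirichlet_addn.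
Qed.

(* Summing over [t = n t'] with [n = 1] modulo [gcd (D, q)] leaves the additive
   character unchanged but multiplies [chi] by [chi n]. *)
Lemma primitive_twisted_sum0 (q : nat) (h : 'Z_q) : (1 < q)%N ->
  primitive_character D chi -> ~~ (D %| q)%N -> h * D%:R = 0 ->
  \sum_(0 <= t < D) (chi t%:Z)%:C * addchar R h ^+ t = 0.
Proof.
move=> q1 prim Dq hD; have D0 := dirichlet_modulus_gt0 chiD.
set g := gcdn D q.
have [n [cn n1 chin]] : exists n : int, [/\ coprimez n D, (n = 1 %[mod g])%Z & chi n != 1].
  apply: contrapT => H.
  have gD : g = D.
    apply: prim; split; first exact: dvdn_gcdl.
    by move=> n cn n1; apply: contrapT => /eqP cn1; apply: H; exists n.
  by move: Dq; rewrite -gD dvdn_gcdr.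
have [m cm [em mn]] := dirichlet_natrep cn.
have hg : h * g%:R = 0.
  have [u v e _] := egcdnP q D0.
  have : h * (u * D)%:R = h * (v * q + gcdn D q)%:R by rewrite e.
  rewrite natrD !natrM pchar_Zp // mulr0 add0r => <-.
  by rewrite [u%:R * _]mulrC mulrA hD mul0r.
have m1 : (m = 1 %[mod g])%N.
  apply/eqP; rewrite -eqz_nat -!modz_nat.
  have -> : ((m%:Z %% g) = (n %% g))%Z.
    have gD : (g%:Z %| D%:Z)%Z by rewrite dvdzE dvdn_gcdl.
    by apply/eqP; rewrite eqz_mod_dvd (dvdz_trans gD) // -eqz_mod_dvd mn.
  by rewrite n1.
have hmod (k : nat) : h * k%:R = h * (k %% g)%:R.
  by rewrite {1}(divn_eq k g) natrD natrM mulrDr [_%:R * g%:R]mulrC mulrA hg mul0r add0r.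
have hm : h * m%:R = h by rewrite hmod m1 -hmod mulr1.
have zD : addchar R h ^+ D = 1.
  by rewrite -addchar_mulrn // -[h *+ D]mulr_natr hD addchar0.
have per k : addchar R h ^+ (k %% D) = addchar R h ^+ k.
  by rewrite [in RHS](divn_eq k D) exprD mulnC exprM zD expr1n mul1r.
apply: (coprime_mul_sum0 (c := (chi n)%:C) D0 cm).
- by move=> t; rewrite dirichlet_modn per.
- move=> t; rewrite dirichlet_muln em exprM -addchar_mulrn // -[h *+ m]mulr_natr hm.
  by rewrite mulrA -(rmorphM (real_complex R)).
- by apply: contraNneq chin => -[] ->.
Qed.
End Character.

Section MainTerm.
Variables (R : realType) (q : nat).
Hypothesis q1 : (1 < q)%N.
Variables (m1 n1 N2 N3 : nat) (T2 T3 : pred nat) (f1 f2 f3 : nat -> R) (a : 'Z_q).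
Hypotheses (f2_le1 : forall t, `|f2 t| <= 1) (f3_le1 : forall t, `|f3 t| <= 1).

Lemma main_term_constant (N1 : nat) : (n1 - m1 <= N1)%N -> (forall t, `|f1 t| <= 1) ->
  normc (\sum_(h | h * 1%:R == 0) frequency_term m1 n1 N2 N3 T2 T3 f1 f2 f3 a h) <=
  `|\sum_(t < N3.+1 | T3 t) f3 t| * N1%:R * `|\sum_(t < N2.+1 | T2 t) f2 t|.
Proof.
move=> le_N1 f1_le1; rewrite (big_pred1 0); last by move=> h /=; rewrite mulr1.
rewrite /frequency_term -mulr_suml.
under eq_bigr do rewrite mul0r.
rewrite -mulr_suml !normcM -rmorph_sum normc_real.
have -> : inverse_sum N2 T2 f2 a 0 = (\sum_(t < N2.+1 | T2 t) f2 t)%:C.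
  rewrite /inverse_sum rmorph_sum; apply: eq_bigr => t _.
  by rewrite !mul0r addchar0 // mulr1.
rewrite normc_real ler_wpM2r // ler_wpM2l //.
apply: le_trans (ler_normc_sum_nat _ _ _) _ => [t|]; last by rewrite ler_nat.
by rewrite addchar0 // expr1n mulr1 normc_real.
Qed.

Lemma main_term_primitive (D : nat) (chi : int -> R) :
  dirichlet_character D chi -> quadratic_character D chi ->
  primitive_character D chi -> ~~ (D %| q)%N -> (forall t, f1 t = chi t%:Z) ->
  normc (\sum_(h | h * D%:R == 0) frequency_term m1 n1 N2 N3 T2 T3 f1 f2 f3 a h) <=
  D%:R * (N3.+1%:R * (2 * D%:R) * N2.+1%:R).
Proof.
move=> chiD chiQ prim Dq f1E; have D0 := dirichlet_modulus_gt0 chiD.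
apply: le_trans (ler_normc_sum _ _ _) _.
apply: le_trans (_ : \sum_(h : 'Z_q | h * D%:R == 0) N3.+1%:R * (2 * D%:R) * N2.+1%:R <= _);
  last first.
  rewrite sumr_const -[leLHS]mulr_natl ler_wpM2r ?mulr_ge0 // ler_nat.
  exact: card_mul_kernel.
have card_sum N (T : pred nat) (B : R) : 0 <= B ->
    \sum_(t < N.+1 | T t) B <= N.+1%:R * B.
  move=> B0; rewrite big_mkcond /= -[N.+1 in leRHS]card_ord mulr_natl -sumr_const.
  by apply: ler_sum => t _; case: ifP.
apply: ler_sum => h /eqP hD; apply: le_trans (ler_normc_sum _ _ _) _.
rewrite -mulrA; apply: le_trans (card_sum N3 T3 _ _); last by rewrite mulr_ge0.
apply: ler_sum => t _; rewrite !normcM normc_real.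
have inv : normc (inverse_sum N2 T2 f2 a h) <= N2.+1%:R.
  apply: le_trans (ler_normc_sum _ _ _) _; rewrite -[leRHS]mulr1.
  apply: le_trans (card_sum N2 T2 1 ler01); apply: ler_sum => t' _.
  by rewrite normcM normc_real normc_addchar mulr1.
have lng : normc (long_sum m1 n1 f1 (h * t%:R)) <= 2 * D%:R.
  have htD : h * t%:R * D%:R = 0 by rewrite mulrAC hD mul0r.
  pose G s := (f1 s)%:C * addchar R (h * t%:R) ^+ s.
  have G1 s : normc (G s) <= 1.
    by rewrite normcM normc_real normcX normc_addchar expr1n mulr1 f1E (dirichlet_le1 chiD).
  have GD s : G (D + s)%N = G s.
    rewrite /G !f1E (dirichlet_addn chiD) exprD -addchar_mulrn //.
    by rewrite -[_ *+ D]mulr_natr htD addchar0 // mul1r.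
  have G0 : \sum_(0 <= s < D) G s = 0.
    rewrite -[RHS](primitive_twisted_sum0 chiD q1 prim Dq htD).
    by apply: eq_bigr => s _; rewrite /G f1E.
  have := periodic_sum_bound D0 n1 GD G1 G0.
  have := periodic_sum_bound D0 m1 GD G1 G0.
  case: (leqP m1 n1) => mn; last first.
    by move=> _ _; rewrite /long_sum big_geq ?(ltnW mn) // normc0 mulr_ge0.
  move=> b1 b2; have -> : long_sum m1 n1 f1 (h * t%:R) =
      \sum_(0 <= s < n1) G s - \sum_(0 <= s < m1) G s.
    by rewrite (big_cat_nat (n := m1)) //= addrAC subrr add0r.
  apply: le_trans (le_normcD _ _) _; rewrite normcN mulr_natl mulr2n.
  exact: lerD.
apply: ler_pM => //; rewrite ?mulr_ge0 ?normc_ge0 //.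
by rewrite -[leRHS]mul1r ler_pM ?normc_ge0.
Qed.
End MainTerm.

End FourierAnalysis.

(** * Windows *)

Section Windows.
Variable R : realType.

Lemma big_window (V : nmodType) (F : nat -> V) (P : pred nat) (m n N : nat) : (n <= N.+1)%N ->
  \sum_(t < N.+1 | (m <= t < n)%N && P t) F t = \sum_(m <= t < n | P t) F t.
Proof.
move=> nN; rewrite (big_nat_widen _ _ _ _ _ nN) (big_nat_widenl _ 0%N) // big_mkord.
by apply: eq_bigl => t; rewrite andbC -andbA [X in P t && X]andbC.
Qed.

Lemma window_prefix_bound (F : nat -> R) (P : pred nat) (m n N : nat) (B : R) :
  (0 < m)%N -> (n <= N.+1)%N -> (forall k, `|\sum_(t < k | P t.+1) F t.+1| <= B) ->
  `|\sum_(t < N.+1 | (m <= t < n)%N && P t) F t| <= 2 * B.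
Proof.
move=> m0 nN H; rewrite big_window //.
have B0 : 0 <= B by apply: le_trans (normr_ge0 _) (H 0%N).
case: (leqP n m) => mn; first by rewrite big_geq // normr0 mulr_ge0.
case: m m0 mn => // m _ mn; rewrite big_add1.
have Hm := H m; have Hn := H n.-1.
rewrite -(big_mkord (fun t => P t.+1) (fun t => F t.+1)) in Hm.
rewrite -(big_mkord (fun t => P t.+1) (fun t => F t.+1)) in Hn.
rewrite (big_cat_nat (n := m)) /= in Hn => //; last lia.
set X := (X in `|X| <= B) in Hm; set Y := (X in `|X| <= _); rewrite -/X -/Y in Hn.
have -> : Y = (X + Y) - X by rewrite addrAC subrr add0r.
by apply: le_trans (ler_normB _ _) _; rewrite mulr_natl mulr2n lerD.
Qed.

Definition window_start (M : R) : nat := `|Num.ceil M|%N.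

Lemma window_start_le (M : R) (t : nat) : 0 < M -> (window_start M <= t)%N = (M <= t%:R).
Proof.
move=> M0; rewrite /window_start -lez_nat gez0_abs ?ceil_ge0 //; last first.
  by apply: lt_trans M0; rewrite ltrN10.
by rewrite ceil_le_int.
Qed.

Lemma window_start_gt0 (M : R) : 0 < M -> (0 < window_start M)%N.
Proof. by move=> M0; rewrite ltnNge window_start_le // -ltNge. Qed.

Definition window_end (Delta M : R) : nat := window_start (M * (1 + Delta)).

Lemma in_windowE (Delta M : R) (t : nat) : 0 < M -> 0 < Delta ->
  in_window Delta M t%:Z <-> (window_start M <= t < window_end Delta M)%N.
Proof.
move=> M0 D0; have MD : 0 < M * (1 + Delta) by rewrite mulr_gt0 // addr_gt0.
by rewrite /in_window /window_end ltnNge !window_start_le // -ltNge.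
Qed.

Lemma in_window_pos (Delta M : R) (t : int) : 0 < M -> in_window Delta M t ->
  exists n : nat, t = n%:Z.
Proof.
case: t => [n|n] M0 /andP[h _]; first by exists n.
by move: (lt_le_trans M0 h); rewrite ltr0z.
Qed.

Lemma ternary_sum_congruence (Delta M1 M2 M3 : R) (f1 f2 f3 : int -> R) (a q N2 N3 : nat) :
  (1 < q)%N -> coprime a q -> 0 < Delta -> 0 < M1 -> 0 < M2 -> 0 < M3 ->
  (window_end Delta M2 <= N2.+1)%N -> (window_end Delta M3 <= N3.+1)%N ->
  ternary_sum Delta M1 M2 M3 f1 f2 f3 a%:Z q =
  congruence_sum (window_start M1) (window_end Delta M1) N2 N3
    (fun t => (window_start M2 <= t < window_end Delta M2)%N && coprime t q)
    (fun t => (window_start M3 <= t < window_end Delta M3)%N && coprime t q)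
    (fun t => f1 t%:Z) (fun t => f2 t%:Z) (fun t => f3 t%:Z) (a%:R : 'Z_q).
Proof.
move=> q1 ca D0 M10 M20 M30 le2 le3.
transitivity (\sum_(window_start M3 <= t3 < window_end Delta M3 | coprime t3 q)
  \sum_(window_start M2 <= t2 < window_end Delta M2 | coprime t2 q)
  \sum_(window_start M1 <= t1 < window_end Delta M1)
    f1 t1%:Z * f2 t2%:Z * f3 t3%:Z * ((t1%:R * t2%:R * t3%:R == a%:R :> 'Z_q) : nat)%:R);
  last first.
  rewrite -(big_window _ _ _ le3); apply: eq_bigr => t3 _.
  by rewrite -(big_window _ _ _ le2).
pose w M := [seq n%:Z | n <- index_iota (window_start M) (window_end Delta M)].
have uw M : uniq (w M) by rewrite map_inj_uniq ?iota_uniq // => x y [].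
have inw M t : 0 < M -> (t \in w M) <-> in_window Delta M t.
  move=> M0; split=> [/mapP[n]|].
    by rewrite mem_index_iota => h ->; apply/in_windowE.
  move=> h; have [n e] := in_window_pos M0 h; rewrite e in h *; apply: map_f.
  by rewrite mem_index_iota; apply/in_windowE.
pose r := [seq (p, t3) | p <- [seq (t1, t2) | t1 <- w M1, t2 <- w M2], t3 <- w M3].
have ur : uniq r.
  apply: allpairs_uniq => //; last by move=> [? ?] [? ?] _ _ [-> ->].
  by apply: allpairs_uniq => // -[? ?] [? ?] _ _ [-> ->].
pose C (t : int * int * int) := ((t.1.1 * t.1.2 * t.2)%R == a%:Z %[mod q])%Z.
rewrite /ternary_sum; set A := (X in \sum_(t \in X) _).
have -> : A = [set` [seq t <- r | C t]].
  apply/seteqP; split => -[[t1 t2] t3] /=.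
    rewrite /A /= => -[h1 h2 h3 h4]; rewrite mem_filter; apply/andP; split; first exact/eqP.
    by apply: allpairs_f; [apply: allpairs_f|]; apply/inw.
  rewrite mem_filter => /andP[h4 /allpairsP[[p t] [/= /allpairsP[[s1 s2] [/= i1 i2 ->]] i3]]].
  move=> e; move: h4; rewrite e => /eqP h4; rewrite /A /=.
  by split=> //=; [apply/(inw M1)|apply/(inw M2)|apply/(inw M3)].
rewrite -fsbig_seq ?filter_uniq // big_filter big_mkcond /r !big_allpairs_dep /=.
under eq_bigr do rewrite exchange_big /=.
rewrite exchange_big /= big_map [RHS]big_mkcond /=; apply: eq_bigr => t3 _.
have cop (t1 t2 : nat) : C (t1%:Z, t2%:Z, t3%:Z) -> coprime t2 q && coprime t3 q.
  rewrite /C /= -!PoszM => /eqP; rewrite !modz_nat => -[e].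
  have : coprime (t1 * t2 * t3) q by rewrite -coprime_modl e coprime_modl.
  by rewrite !coprimeMl => /andP[/andP[_ ->] ->].
have CE (t1 t2 : nat) : C (t1%:Z, t2%:Z, t3%:Z) = (t1%:R * t2%:R * t3%:R == a%:R :> 'Z_q).
  by rewrite /C /= -!PoszM !modz_nat eqz_nat -!natrM Zq_natr_eq.
rewrite exchange_big /= big_map.
case: ifP => c3; last first.
  rewrite big1 // => t2 _; rewrite big_map big1 // => t1 _.
  by case: ifP => // /cop/andP[_]; rewrite c3.
rewrite [RHS]big_mkcond /=; apply: eq_bigr => t2 _; rewrite big_map.
case: ifP => c2; last first.
  by rewrite big1 // => t1 _; case: ifP => // /cop/andP[]; rewrite c2.
apply: eq_bigr => t1 _; rewrite CE; case: eqP => _; by rewrite ?mulr1 ?mulr0.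
Qed.
End Windows.

Section PerModulus.
Import complex.ComplexField.Normc.
Variables (R : realType) (q : nat) (D : nat) (chi : int -> R).
Hypotheses (q1 : (1 < q)%N) (chiD : dirichlet_character D chi)
  (chiQ : quadratic_character D chi) (chiP : primitive_character D chi).
Variables (m1 n1 m2 n2 m3 n3 N1 N2 N3 : nat).
Hypotheses (le_m1n1 : (m1 <= n1)%N) (le_N1 : (n1 - m1 <= N1)%N)
  (le_N21 : (N2 <= N1)%N) (le_N32 : (N3 <= N2)%N)
  (m2_gt0 : (0 < m2)%N) (m3_gt0 : (0 < m3)%N)
  (le_n2 : (n2 <= N2.+1)%N) (le_n3 : (n3 <= N3.+1)%N).
Variables (a d : nat) (w B : R).
Hypotheses (coprime_aq : coprime a q) (B_ge0 : 0 <= B)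
  (taud : forall n, (0 < n)%N -> (n <= q.*2 * N3)%N -> (tau n <= d)%N) (w_ge0 : 0 <= w)
  (w4 : 24 * (D ^ 7 * N3.+1 ^ 3 * N1 * d * inverse_energy N2 q)%:R <= w ^+ 4)
  (chiB : forall n, `|\sum_(t < n | coprime t.+1 q) chi t.+1%:Z| <= B).

Let T2 t := (m2 <= t < n2)%N && coprime t q.
Let T3 t := (m3 <= t < n3)%N && coprime t q.
Let T2P t : T2 t -> (0 < t)%N && coprime t q.
Proof. by move=> /andP[/andP[mt _] ->]; rewrite (leq_trans m2_gt0 mt). Qed.
Let T3P t : T3 t -> (0 < t)%N && coprime t q.
Proof. by move=> /andP[/andP[mt _] ->]; rewrite (leq_trans m3_gt0 mt). Qed.
Let L := (trunc_log 2 q).+1.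
Let S (f1 f2 f3 : int -> R) : R := congruence_sum m1 n1 N2 N3 T2 T3
  (fun t => f1 t%:Z) (fun t => f2 t%:Z) (fun t => f3 t%:Z) (a%:R : 'Z_q).

Let bound : R := N1%:R * (2 * B) * N2.+1%:R + D%:R * (N3.+1%:R * (2 * D%:R) * N2.+1%:R) +
  q%:R * (2 * L%:R * w).

Let le_N31 : (N3 <= N1)%N. Proof. exact: leq_trans le_N21. Qed.
Let a_unit : (a%:R : 'Z_q) \is a GRing.unit. Proof. by rewrite Zq_unit. Qed.
Let D0 : (0 < D)%N := dirichlet_modulus_gt0 chiD.

Let trivial_window (f : nat -> R) (N : nat) (T : pred nat) : (forall t, `|f t| <= 1) ->
  `|\sum_(t < N.+1 | T t) f t| <= N.+1%:R.
Proof.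
move=> f1; apply: le_trans (ler_norm_sum _ _ _) _; rewrite big_mkcond /=.
rewrite -[N.+1 in leRHS]card_ord -sumr_const.
by apply: ler_sum => t _; case: ifP.
Qed.

Lemma constant_case (f2 f3 : int -> R) :
  (forall t, `|f2 t| <= 1) -> (forall t, `|f3 t| <= 1) -> f2 = chi \/ f3 = chi ->
  q%:R * `|S (cst 1) f2 f3| <= bound.
Proof.
move=> f2_le1 f3_le1 chi23.
have one1 (t : int) : `|cst (1 : R) t| <= 1 by rewrite normr1.
have w4' : 24 * (1 ^ 7 * N3.+1 ^ 3 * N1 * d * inverse_energy N2 q)%:R <= w ^+ 4.
  by apply: le_trans w4; rewrite ler_wpM2l // ler_nat !leq_mul2r exp1n expn_gt0 D0 !orbT.
have := congruence_sum_bound (D := 1) q1 isT le_m1n1 le_N1 le_N31 T2P T3P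
  (fun t : nat => one1 t%:Z) (fun t : nat => f2_le1 t%:Z) (fun t : nat => f3_le1 t%:Z)
  (fun _ => erefl) a_unit taud w_ge0 w4'.
move/le_trans; apply; rewrite lerD2r.
apply: le_trans (main_term_constant _ _ _ _ _ _ _ le_N1 (fun t : nat => one1 t%:Z)) _.
rewrite -[leLHS]addr0 lerD ?mulr_ge0 //.
have h2 : `|\sum_(t < N2.+1 | T2 t) f2 t%:Z| <= N2.+1%:R.
  exact: (@trivial_window (fun t : nat => f2 t%:Z) N2 T2 (fun t => f2_le1 _)).
have h3 : `|\sum_(t < N3.+1 | T3 t) f3 t%:Z| <= N2.+1%:R.
  apply: le_trans (@trivial_window (fun t : nat => f3 t%:Z) N3 T3 (fun t => f3_le1 _)) _.
  by rewrite ler_nat.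
rewrite -mulrA mulrCA -mulrA ler_wpM2l //.
case: chi23 => e.
  rewrite mulrC ler_pM // e.
  exact: (@window_prefix_bound _ (fun t => chi t%:Z) (coprime^~ q)).
rewrite ler_pM // e.
exact: (@window_prefix_bound _ (fun t => chi t%:Z) (coprime^~ q)).
Qed.

(* If [D %| q] the congruence turns [chi t1] into [chi a * chi t2 * chi t3]. *)
Lemma twist_transfer : (D %| q)%N -> `|S chi (cst 1) (cst 1)| <= `|S (cst 1) chi chi|.
Proof.
move=> Dq.
have -> : S chi (cst 1) (cst 1) = chi a%:Z * S (cst 1) chi chi.
  rewrite /S /congruence_sum mulr_sumr; apply: eq_bigr => t3 /T3P/andP[_ c3].
  rewrite mulr_sumr; apply: eq_bigr => t2 /T2P/andP[_ c2].
  rewrite mulr_sumr; apply: eq_bigr => t1 _ /=.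
  case: eqP => e; rewrite ?mulr0 // !mulr1 mul1r.
  have <- : chi (t1 * t2 * t3)%N%:Z = chi a%:Z.
    rewrite -(dirichlet_modn chiD) -[in RHS](dirichlet_modn chiD).
    have : (t1 * t2 * t3 = a %[mod q])%N.
      by apply/eqP; rewrite -(Zq_natr_eq q1) !natrM; apply/eqP.
    by move=> h; rewrite -(modn_dvdm _ Dq) h modn_dvdm.
  have sq (t : nat) : coprime t q -> chi t%:Z ^+ 2 = 1.
    by move=> ct; apply: chiQ.1; rewrite coprimezE; exact: coprime_dvdr Dq ct.
  rewrite !(dirichlet_muln chiD).
  have -> : chi t1 * chi t2 * chi t3 * (chi t2 * chi t3) =
    chi t1 * chi t2%:Z ^+ 2 * chi t3%:Z ^+ 2 by ring.
  by rewrite !sq // !mulr1.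
by rewrite normrM ler_piMl // (dirichlet_le1 chiD chiQ).
Qed.

Lemma twisted_sum_bound (f1 f2 f3 : int -> R) : one_twist chi f1 f2 f3 ->
  q%:R * `|S f1 f2 f3| <= bound.
Proof.
have chi1 := dirichlet_le1 chiD chiQ.
have one1 (t : int) : `|cst (1 : R) t| <= 1 by rewrite normr1.
case=> -[/funext -> /funext -> /funext ->]; last 2 first.
- by apply: constant_case => //; left.
- by apply: constant_case => //; right.
have [Dq|Dq] := boolP (D %| q)%N.
  apply: le_trans (constant_case chi1 chi1 (or_introl erefl)).
  by rewrite ler_wpM2l // twist_transfer.
have := congruence_sum_bound q1 D0 le_m1n1 le_N1 le_N31 T2P T3P
  (fun t : nat => chi1 t%:Z) (fun t : nat => one1 t%:Z) (fun t : nat => one1 t%:Z)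
  (dirichlet_addn chiD) a_unit taud w_ge0 w4.
move/le_trans; apply; rewrite lerD2r.
apply: le_trans (main_term_primitive q1 m1 n1 N2 N3 T2 T3 a%:R (fun t : nat => one1 t%:Z)
  (fun t : nat => one1 t%:Z) chiD chiQ chiP Dq (fun t => erefl)) _.
by rewrite lerDr !mulr_ge0.
Qed.
End PerModulus.

(** * Exceptional moduli *)

Section ExceptionalModuli.
Variable R : realType.

Definition tau_max (Q : R) : nat := \max_(n < (Num.truncn (Q ^+ 5)).+1) tau n.

Lemma tau_le_max (Q : R) (n : nat) : 0 <= Q -> n%:R <= Q ^+ 5 -> (tau n <= tau_max Q)%N.
Proof.
move=> Q0 nQ; have h : (n < (Num.truncn (Q ^+ 5)).+1)%N.
  by rewrite ltnS truncn_ge_nat // exprn_ge0.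
exact: (@leq_bigmax_cond _ predT (fun i : 'I__ => tau i) (Ordinal h)).
Qed.

Lemma tau_max_gt0 (Q : R) : 0 <= Q -> (0 < tau_max Q)%N.
Proof.
move=> Q0; apply: leq_trans (tau_gt0 0) (tau_le_max Q0 _).
by rewrite exprn_ge0.
Qed.

Lemma tau_max_bound (e : R) : 0 < e ->
  exists2 C : R, 1 <= C & forall Q, 1 <= Q -> (tau_max Q)%:R <= C * (Q `^ e) ^+ 5.
Proof.
move=> e0; have [C C1 HC] := tau_bound e0; exists C => // Q Q1.
have Q0 : 0 <= Q by apply: le_trans Q1.
have Qe1 : 1 <= Q `^ e by rewrite -(powRr0 Q) ler_powR // ltW.
rewrite /tau_max; elim/big_ind: _ => [|m n Hm Hn|n _].
- by rewrite mulr_ge0 ?exprn_ge0 ?powR_ge0 // (le_trans _ C1).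
- by rewrite /maxn; case: ifP.
case: n => -[|n] /= nQ.
  by rewrite /tau /= -[1%:R]mulr1 ler_pM // exprn_ege1.
apply: le_trans (HC n.+1 isT) _; rewrite ler_wpM2l ?(le_trans _ C1) //.
rewrite -powR_mulrn ?powR_ge0 // powRAC powR_mulrn //.
apply: ge0_ler_powR; rewrite ?nnegrE ?exprn_ge0 ?(ltW e0) //.
by rewrite -truncn_ge_nat ?exprn_ge0.
Qed.

Definition delta_exponent (Q : R) : R := ln (3 * (tau_max Q)%:R) / ln Q.

Lemma powR_delta_exponent (Q : R) : 1 < Q ->
  Q `^ delta_exponent Q = 3 * (tau_max Q)%:R.
Proof.
move=> Q1; have Q0 : 0 < Q by apply: lt_trans Q1.
rewrite /powR gt_eqF // /delta_exponent divfK ?gt_eqF ?ln_gt0 // lnK // posrE.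
by rewrite mulr_gt0 // ltr0n tau_max_gt0 // ltW.
Qed.

Lemma delta_exponent_cvg : delta_exponent Q @[Q --> +oo] --> (0 : R).
Proof.
apply/cvgr0Pnorm_le => e e0.
have e60 : 0 < e / 6 by rewrite divr_gt0.
have [C C1 HC] := tau_max_bound e60.
near=> Q.
have Q1 : 1 < Q by near: Q; apply: nbhs_pinfty_gt; rewrite num_real.
have Q0 : 0 < Q by apply: lt_trans Q1.
have QC : expR (ln (3 * C) / (e / 6)) <= Q.
  by near: Q; apply: nbhs_pinfty_ge; rewrite num_real.
have lQ : 0 < ln Q by rewrite ln_gt0.
have T1 : 1 <= (tau_max Q)%:R :> R by rewrite ler1n tau_max_gt0 // ltW.
have C0 : 0 < C by apply: lt_le_trans C1.
rewrite /delta_exponent normrM normfV (gtr0_norm lQ) ler_pdivrMr // ger0_norm; last first.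
  by rewrite ln_ge0 // (le_trans T1) // ler_peMl // ler1n.
apply: le_trans (_ : ln (3 * C * (Q `^ (e / 6)) ^+ 5) <= _).
  rewrite ler_ln ?posrE ?mulr_gt0 ?exprn_gt0 ?powR_gt0 //; last by apply: lt_le_trans T1.
  by rewrite -mulrA ler_wpM2l // HC // ltW.
rewrite lnM ?posrE ?mulr_gt0 ?exprn_gt0 ?powR_gt0 // lnXn ?powR_gt0 // ln_powR.
have : ln (3 * C) <= (e / 6) * ln Q.
  by rewrite [leRHS]mulrC -ler_pdivrMr // -[leLHS]expRK ler_ln ?posrE ?expR_gt0.
rewrite -mulr_natl; lra.
Unshelve. all: by end_near.
Qed.

Lemma exceptional_moduli (kappa Q M : R) : 512 <= Q -> 0 < M -> M <= 2 * Q ->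
  exists E : seq nat, (size E)%:R <= Q `^ (1 - 4 * kappa + delta_exponent Q) /\
    forall q : nat, Q <= q%:R <= 2 * Q -> q \notin E ->
      (inverse_energy (Num.truncn (2 * M)) q)%:R <=
      Q `^ (4 * kappa) * ((2 * M) ^+ 2 + (2 * M) ^+ 4 / Q).
Proof.
move=> Q512 M0 MQ; set N := Num.truncn (2 * M).
have Q0 : 0 < Q by apply: (lt_le_trans _ Q512); rewrite ltr0n.
have Q1 : 1 < Q by apply: lt_le_trans Q512; rewrite ltr1n.
pose thr : R := Q `^ (4 * kappa) * ((2 * M) ^+ 2 + (2 * M) ^+ 4 / Q).
pose Qs := [seq q <- iota 0 (Num.truncn (2 * Q)).+1 | Q <= q%:R].
pose E := [seq q <- Qs | thr < (inverse_energy N q)%:R].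
exists E; split; last first.
  move=> q /andP[q1 q2] qE; rewrite leNgt; apply: contra qE => h.
  rewrite !mem_filter q1 mem_iota /= add0n ltnS truncn_ge_nat ?q2 ?andbT //.
  by rewrite mulr_ge0 // ltW.
have NM : N%:R <= 2 * M by rewrite truncn_le mulr_ge0 // ltW.
have M20 : 0 < 2 * M by rewrite mulr_gt0.
set W := (2 * M) ^+ 2 + (2 * M) ^+ 4 / Q.
have W0 : 0 < W by rewrite addr_gt0 ?divr_gt0 ?exprn_gt0.
have thr0 : 0 < thr by rewrite mulr_gt0 // powR_gt0.
have sE : (size E)%:R * thr <= (\sum_(q <- Qs) inverse_energy N q)%:R.
  rewrite -sum1_size natr_sum mulr_suml /E big_filter natr_sum.
  rewrite [leRHS](bigID (fun q => thr < (inverse_energy N q)%:R)) /=.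
  rewrite -[leLHS]addr0 lerD //; last by rewrite sumr_ge0.
  by apply: ler_sum => q h; rewrite mul1r ltW.
have taud n : (0 < n)%N -> (n <= 2 * N ^ 4)%N -> (tau n <= tau_max Q)%N.
  move=> n0 nN; apply: tau_le_max; first exact: ltW.
  apply: le_trans (_ : 2 * (4 * Q) ^+ 4 <= _).
    apply: le_trans (_ : (2 * N ^ 4)%:R <= _); first by rewrite ler_nat.
    rewrite natrM natrX ler_wpM2l // lerXn2r ?nnegrE ?mulr_ge0 ?(ltW Q0) //.
    by apply: le_trans NM _; lra.
  have -> : 2 * (4 * Q) ^+ 4 = 512 * Q ^+ 4 by ring.
  by rewrite [leRHS]exprS ler_wpM2r // exprn_ge0 // ltW.
have uQs : uniq Qs by rewrite filter_uniq // iota_uniq.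
have := inverse_energy_sum uQs taud; rewrite -(ler_nat R) => /(le_trans sE).
have sQs : (size Qs)%:R <= 3 * Q.
  apply: le_trans (_ : (Num.truncn (2 * Q)).+1%:R <= _).
    by rewrite ler_nat size_filter -[leqRHS](size_iota 0) count_size.
  rewrite -natr1; have : (Num.truncn (2 * Q))%:R <= 2 * Q.
    by rewrite truncn_le mulr_ge0 // ltW.
  lra.
set T := tau_max Q.
have -> : (size Qs * (N ^ 2 * T) + N ^ 4 * T)%:R =
    (size Qs)%:R * (N%:R ^+ 2 * T%:R) + N%:R ^+ 4 * T%:R :> R.
  by rewrite -!natrX -!natrM -natrD.
move=> H.
have N2 : N%:R ^+ 2 <= (2 * M) ^+ 2 by rewrite lerXn2r ?nnegrE // ltW.
have N4 : N%:R ^+ 4 <= (2 * M) ^+ 4 by rewrite lerXn2r ?nnegrE // ltW.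
have H2 : (size E)%:R * thr <= 3 * T%:R * Q * W.
  apply: le_trans H _.
  have -> : 3 * T%:R * Q * W = (3 * Q) * ((2 * M) ^+ 2 * T%:R) + 3 * ((2 * M) ^+ 4 * T%:R).
    by rewrite /W; field; rewrite gt_eqF.
  rewrite lerD //.
    by rewrite ler_pM ?mulr_ge0 ?exprn_ge0 // ler_wpM2r.
  apply: le_trans (_ : 1 * ((2 * M) ^+ 4 * T%:R) <= _); first by rewrite mul1r ler_wpM2r.
  rewrite ler_wpM2r ?ler1n //; apply: mulr_ge0 => //.
  by rewrite exprn_ge0 // ltW.
rewrite powRD; last by rewrite (gt_eqF Q0) implybT.
rewrite powR_delta_exponent // powRB; last by rewrite (gt_eqF Q0) implybT.
rewrite powRr1 ?(ltW Q0) // mulrAC ler_pdivlMr ?powR_gt0 //.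
rewrite -(ler_pM2r W0); have := H2; rewrite /thr mulrA => /le_trans; apply.
by rewrite [3 * T%:R * Q]mulrC.
Qed.
End ExceptionalModuli.

(** * Sizes of the parameters *)

(* Applied with [u, m, v] the fourth roots of [x, M2, Q] and [k = Q ^ kappa]. *)
Lemma fourth_power_le (R : realFieldType) (D X k u m v : R) :
  1 <= D -> 1 <= X -> 0 <= k -> 0 <= u -> 0 <= m -> 0 < v ->
  D ^+ 7 * (u ^+ 4 * m ^+ 4) * X * k ^+ 4 * (m ^+ 8 + m ^+ 16 / v ^+ 4) <=
  (D ^+ 2 * X * k * (u * m ^+ 3 + u * m ^+ 5 / v)) ^+ 4.
Proof.
move=> D1 X1 k0 u0 m0 v0.
have D0 : 0 <= D by apply: le_trans D1.
have X0 : 0 <= X by apply: le_trans X1.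
have mv : 0 <= m ^+ 5 / v by rewrite divr_ge0 ?exprn_ge0 ?(ltW v0).
have key (y z : R) : 0 <= y -> 0 <= z -> y ^+ 4 + z ^+ 4 <= (y + z) ^+ 4.
  move=> y0 z0; rewrite -subr_ge0.
  have -> : (y + z) ^+ 4 - (y ^+ 4 + z ^+ 4) = y * z * (4 * y ^+ 2 + 6 * y * z + 4 * z ^+ 2).
    by ring.
  by rewrite !(mulr_ge0, addr_ge0) ?sqr_ge0.
have -> : D ^+ 7 * (u ^+ 4 * m ^+ 4) * X * k ^+ 4 * (m ^+ 8 + m ^+ 16 / v ^+ 4) =
  D ^+ 7 * X * (u ^+ 4 * k ^+ 4 * ((m ^+ 3) ^+ 4 + (m ^+ 5 / v) ^+ 4)).
  by field; rewrite gt_eqF.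
have -> : (D ^+ 2 * X * k * (u * m ^+ 3 + u * m ^+ 5 / v)) ^+ 4 =
  D ^+ 8 * X ^+ 4 * (u ^+ 4 * k ^+ 4 * (m ^+ 3 + m ^+ 5 / v) ^+ 4).
  by field; rewrite gt_eqF.
apply: ler_pM; rewrite ?mulr_ge0 ?exprn_ge0 ?addr_ge0 ?exprn_ge0 //.
  apply: ler_pM; rewrite ?exprn_ge0 //; first by rewrite ler_weXn2l.
  by rewrite -[leLHS]expr1 ler_weXn2l.
by rewrite ler_wpM2l ?mulr_ge0 ?exprn_ge0 // key // exprn_ge0.
Qed.

Lemma le_cube_root (R : realType) (c x : R) : 0 <= c -> c `^ 3 <= x -> c <= x `^ (1 / 3).
Proof.
move=> c0 cx; have e : (c `^ 3) `^ (1 / 3) = c.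
  by rewrite -powRrM mulrC divfK ?pnatr_eq0 // powRr1.
rewrite -[leLHS]e; apply: ge0_ler_powR; rewrite ?nnegrE ?divr_ge0 ?powR_ge0 //.
by apply: le_trans cx; rewrite powR_ge0.
Qed.

Section Sizes.
Variables (R : realType) (alpha x Q Dr M2 M3 qr : R).
Hypotheses (alpha_gt0 : 0 < alpha) (alpha_lt : alpha < 1 / 100)
  (x_ge1 : 1 <= x) (cube_root_ge : 1024 <= x `^ (1 / 3)) (Q_gt0 : 0 < Q) (D_ge1 : 1 <= Dr) (q_ge1 : 1 <= qr)
  (q_le_2Q : qr <= 2 * Q)
  (adm : x / qr `^ (3 / 2 + alpha) <= M3) (le_M32 : M3 <= M2)
  (DQ : Dr ^+ 2 * Q < x `^ (2 / 3 - 4 * alpha)) (M2_le : M2 <= x `^ (1 / 3)).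

Let x_gt0 : 0 < x. Proof. exact: lt_le_trans x_ge1. Qed.

Lemma cube_rootK : (x `^ (1 / 3)) ^+ 3 = x.
Proof.
rewrite -powR_mulrn ?powR_ge0 // -powRrM (_ : 1 / 3 * 3%:R = 1) ?powRr1 ?(ltW x_gt0) //.
by field.
Qed.

Lemma cube_root_le_modulus : x `^ (1 / 3) <= 2 * Q.
Proof.
apply: le_trans q_le_2Q; set c := x `^ (1 / 3).
have c0 : 0 < c by rewrite powR_gt0.
have qp : 0 < qr `^ (3 / 2 + alpha) by rewrite powR_gt0 // (lt_le_trans _ q_ge1).
have h : x <= c * qr ^+ 2.
  apply: le_trans (_ : c * qr `^ (3 / 2 + alpha) <= _).
    by rewrite -ler_pdivrMr // (le_trans adm) // (le_trans le_M32).
  rewrite ler_wpM2l ?(ltW c0) // -powR_mulrn ?(le_trans _ q_ge1) //.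
  by rewrite ler_powR //; move: alpha_gt0 alpha_lt; lra.
move: h; rewrite -{1}cube_rootK -/c exprS ler_pM2l //.
by rewrite ler_pXn2r // nnegrE ?(ltW c0) // (le_trans _ q_ge1).
Qed.

Lemma Q_le_two_thirds : Q <= x `^ (2 / 3).
Proof.
apply: le_trans (_ : Dr ^+ 2 * Q <= _).
  by rewrite ler_peMl ?(ltW Q_gt0) // exprn_ege1.
apply: le_trans (ltW DQ) _; rewrite ler_powR //; move: alpha_gt0 alpha_lt; lra.
Qed.

Lemma Q_le_x : Q <= x.
Proof.
apply: le_trans Q_le_two_thirds _; rewrite -[leRHS]powRr1 ?(ltW x_gt0) // ler_powR //; move: alpha_gt0 alpha_lt; lra.
Qed.

Lemma Q_ge : 512 <= Q.
Proof. have := le_trans cube_root_ge cube_root_le_modulus; lra. Qed.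

Lemma short_side_ge (e : R) : 0 <= e -> e <= alpha / 8 ->
  Dr ^+ 2 * x `^ e * Q `^ (alpha / 2) <= 4 * M3.
Proof.
move=> e0 ea.
have q0 : 0 < qr by apply: lt_le_trans q_ge1.
have h1 : qr `^ (3 / 2 + alpha) <= 4 * Q `^ (3 / 2 + alpha).
  apply: le_trans (_ : (2 * Q) `^ (3 / 2 + alpha) <= _).
    by apply: ge0_ler_powR; rewrite ?nnegrE ?mulr_ge0 ?(ltW Q_gt0) ?(ltW q0) //; move: alpha_gt0 alpha_lt; lra.
  rewrite powRM ?(ltW Q_gt0) // ler_wpM2r ?powR_ge0 //.
  apply: le_trans (_ : 2 `^ 2%:R <= _); first by rewrite ler_powR ?ler1n //; move: alpha_gt0 alpha_lt; lra.
  by rewrite powR_mulrn // -natrX.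
have h2 : x <= 4 * Q `^ (3 / 2 + alpha) * M3.
  move: adm; rewrite ler_pdivrMr ?powR_gt0 // => /le_trans; apply.
  rewrite mulrC ler_wpM2r // (le_trans _ adm) // divr_ge0 ?powR_ge0 //.
  exact: ltW.
rewrite -(ler_pM2r (powR_gt0 (3 / 2 + alpha) Q_gt0)).
apply: le_trans (_ : x <= _); last by rewrite mulrAC.
have D3 : Dr ^+ 2 * Q `^ (3 / 2) <= x `^ (1 - 6 * alpha).
  apply: le_trans (_ : (Dr ^+ 2 * Q) `^ (3 / 2) <= _).
    rewrite powRM ?exprn_ge0 ?(le_trans _ D_ge1) ?(ltW Q_gt0) //.
    rewrite ler_wpM2r ?powR_ge0 //.
    rewrite le1r_powR ?exprn_ege1 //; move: alpha_gt0 alpha_lt; lra.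
  apply: le_trans (_ : (x `^ (2 / 3 - 4 * alpha)) `^ (3 / 2) <= _).
    apply: ge0_ler_powR; rewrite ?nnegrE ?powR_ge0 ?(ltW DQ) //.
    by rewrite mulr_ge0 ?sqr_ge0 ?(ltW Q_gt0).
  rewrite -powRrM ler_powR //; move: alpha_gt0 alpha_lt; lra.
have Qa : Q `^ (alpha / 2) * Q `^ alpha <= x `^ (3 / 2 * alpha).
  rewrite -powRD; last by rewrite (gt_eqF Q_gt0) implybT.
  have -> : alpha / 2 + alpha = 3 / 2 * alpha by lra.
  apply: ge0_ler_powR; rewrite ?nnegrE ?(ltW Q_gt0) ?(ltW x_gt0) ?Q_le_x //; move: alpha_gt0 alpha_lt; lra.
have -> : Dr ^+ 2 * x `^ e * Q `^ (alpha / 2) * Q `^ (3 / 2 + alpha) =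
    (Dr ^+ 2 * Q `^ (3 / 2)) * x `^ e * (Q `^ (alpha / 2) * Q `^ alpha).
  rewrite [Q `^ (3 / 2 + alpha)]powRD; last by rewrite (gt_eqF Q_gt0) implybT.
  ring.
apply: le_trans (_ : x `^ (1 - 6 * alpha) * x `^ e * x `^ (3 / 2 * alpha) <= _).
  have D20 : 0 <= Dr ^+ 2 * Q `^ (3 / 2) by rewrite mulr_ge0 ?sqr_ge0 ?powR_ge0.
  apply: ler_pM => //; [by apply: mulr_ge0; rewrite ?powR_ge0 | by rewrite mulr_ge0 ?powR_ge0 |].
  by rewrite ler_wpM2r ?powR_ge0.
rewrite -!powRD ?(gt_eqF x_gt0) ?implybT //.
rewrite -[leRHS]powRr1 ?(ltW x_gt0) // ler_powR //; move: alpha_gt0 alpha_lt; lra.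
Qed.
End Sizes.

Lemma window_end_le (R : realType) (Delta M : R) : 0 < M -> 0 < Delta -> Delta <= 1 ->
  (window_end Delta M <= (Num.truncn (2 * M)).+1)%N.
Proof.
move=> M0 D0 D1; rewrite /window_end window_start_le ?mulr_gt0 ?addr_gt0 //.
apply: le_trans (ltW (truncnS_gt _)); rewrite mulrC ler_wpM2r ?(ltW M0) //.
by rewrite -natr1 addrC lerD2r.
Qed.

Lemma window_start_le_end (R : realType) (Delta M : R) : 0 < M -> 0 < Delta ->
  (window_start M <= window_end Delta M)%N.
Proof.
move=> M0 D0; rewrite window_start_le //.
have MD : 0 < M * (1 + Delta) by rewrite mulr_gt0 // addr_gt0.
apply: le_trans (_ : M * (1 + Delta) <= _); first by rewrite ler_peMr ?(ltW M0) // lerDl ltW.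
by rewrite -window_start_le.
Qed.

Lemma main_size (R : realFieldType) (D C y M1 M2 M3 N1 P2 P3 : R) :
  1 <= D -> 1 <= C -> 1 <= y -> 0 <= M3 -> M3 <= M1 -> 0 <= M2 ->
  0 <= N1 -> 0 <= P2 -> 0 <= P3 -> N1 <= 2 * M1 -> P2 <= 3 * M2 -> P3 <= 3 * M3 ->
  N1 * (2 * (D * C * (2 * y))) * P2 + D * (P3 * (2 * D) * P2) <=
  42 * C * (D ^+ 2 * y * (M1 * M2)).
Proof.
move=> D1 C1 y1 M30 M31 M20 N10 P20 P30 hN h2 h3.
have D0 : 0 <= D by apply: le_trans D1.
have C0 : 0 <= C by apply: le_trans C1.
have y0 : 0 <= y by apply: le_trans y1.
have M10 : 0 <= M1 by apply: le_trans M31.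
have -> : 42 * C * (D ^+ 2 * y * (M1 * M2)) =
  (2 * M1) * (2 * (D * D * C * (2 * y))) * (3 * M2) + 18 * D ^+ 2 * (C * y) * (M1 * M2).
  by ring.
apply: lerD.
  apply: ler_pM => //; first by rewrite !mulr_ge0.
  apply: ler_pM => //; first by rewrite !mulr_ge0.
  rewrite ler_wpM2l // !ler_wpM2r ?mulr_ge0 //.
  by rewrite ler_peMl.
have -> : 18 * D ^+ 2 * (C * y) * (M1 * M2) = D * ((3 * M1) * (2 * D) * (3 * M2)) * (C * y).
  by ring.
have hP : P3 * (2 * D) * P2 <= (3 * M1) * (2 * D) * (3 * M2).
  apply: ler_pM => //; first by rewrite !mulr_ge0.
  by rewrite ler_wpM2r ?mulr_ge0 // (le_trans h3) // ler_wpM2l.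
apply: le_trans (_ : D * ((3 * M1) * (2 * D) * (3 * M2)) * 1 <= _).
  by rewrite mulr1 ler_wpM2l.
rewrite ler_wpM2l ?mulr_ge0 //.
by rewrite -[1]mulr1 ler_pM.
Qed.

Lemma energy_size (R : realFieldType) (D M1 M2 M3 N1 P3 X x k Q J d : R) :
  0 <= D -> 0 < M2 -> 0 <= M3 -> M3 <= M2 -> 0 <= M1 -> M1 * M2 * M3 <= x -> 0 <= X ->
  0 < Q -> 0 <= J -> 0 <= N1 -> 0 <= P3 -> 0 <= d ->
  N1 <= 2 * M1 -> P3 <= 3 * M3 -> d <= X ->
  J <= k ^+ 4 * ((2 * M2) ^+ 2 + (2 * M2) ^+ 4 / Q) ->
  24 * (D ^+ 7 * P3 ^+ 3 * N1 * d * J) <=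
  12 ^+ 4 * (D ^+ 7 * (x * M2) * X * k ^+ 4 * (M2 ^+ 2 + M2 ^+ 4 / Q)).
Proof.
move=> D0 M20 M30 M32 M10 Mx X0 Q0 J0 N10 P30 d0 hN hP hd hJ.
have M2' := ltW M20.
have k4 : 0 <= k ^+ 4 by rewrite -[4%N]/(2 * 2)%N exprM sqr_ge0.
have W0 : 0 <= M2 ^+ 2 + M2 ^+ 4 / Q.
  by rewrite addr_ge0 ?divr_ge0 ?exprn_ge0 // ltW.
have hJ' : J <= 16 * k ^+ 4 * (M2 ^+ 2 + M2 ^+ 4 / Q).
  apply: le_trans hJ _; rewrite -subr_ge0.
  have -> : 16 * k ^+ 4 * (M2 ^+ 2 + M2 ^+ 4 / Q) - k ^+ 4 * ((2 * M2) ^+ 2 + (2 * M2) ^+ 4 / Q) =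
    k ^+ 4 * (12 * M2 ^+ 2) by ring.
  by apply: mulr_ge0 => //; apply: mulr_ge0 => //; apply: sqr_ge0.
have MM : M3 ^+ 3 * M1 <= x * M2.
  have : M3 ^+ 3 * M1 * M2 <= x * M2 * M2.
    apply: le_trans (_ : (M1 * M2 * M3) * M3 ^+ 2 <= _).
      by rewrite le_eqVlt; apply/orP; left; apply/eqP; ring.
    rewrite -[x * M2 * M2]mulrA -expr2 ler_pM ?mulr_ge0 ?sqr_ge0 //.
    by rewrite lerXn2r ?nnegrE.
  by rewrite ler_pM2r.
have P33 : P3 ^+ 3 <= 27 * M3 ^+ 3.
  have -> : 27 * M3 ^+ 3 = (3 * M3) ^+ 3 by ring.
  by rewrite lerXn2r ?nnegrE ?mulr_ge0.
have -> : 12 ^+ 4 * (D ^+ 7 * (x * M2) * X * k ^+ 4 * (M2 ^+ 2 + M2 ^+ 4 / Q)) =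
  24 * (D ^+ 7 * (54 * (x * M2)) * X * (16 * k ^+ 4 * (M2 ^+ 2 + M2 ^+ 4 / Q))).
  by ring.
rewrite ler_wpM2l //; apply: ler_pM => //; first by rewrite !mulr_ge0 ?exprn_ge0.
apply: ler_pM => //; first by rewrite !mulr_ge0 ?exprn_ge0.
rewrite -mulrA ler_wpM2l ?exprn_ge0 //.
apply: le_trans (_ : (27 * M3 ^+ 3) * (2 * M1) <= _).
  by rewrite ler_pM ?exprn_ge0.
have -> : 27 * M3 ^+ 3 * (2 * M1) = 54 * (M3 ^+ 3 * M1) by ring.
by rewrite ler_wpM2l.
Qed.

Lemma powR_ge1 (R : realType) (c r : R) : 1 <= c -> 0 <= r -> 1 <= c `^ r.
Proof. by move=> c1 r0; rewrite -(powRr0 c) ler_powR. Qed.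

Definition bounds_typical_moduli (R : realType) (alpha kappa eps K : R) : Prop :=
  forall (x Q : R) (D : nat) (chi : int -> R) (Delta M1 M2 M3 : R)
    (f1 f2 f3 : int -> R) (q : nat),
  1 <= x -> 1024 <= x `^ (1 / 3) -> 4 <= x `^ (alpha / 8) -> 0 < Q ->
  dirichlet_character D chi -> quadratic_character D chi -> primitive_character D chi ->
  0 < Delta -> Delta <= 1 -> M1 * M2 * M3 <= x -> M3 <= M2 -> M2 <= M1 ->
  one_twist chi f1 f2 f3 ->
  D%:R ^+ 2 * Q < x `^ (2 / 3 - 4 * alpha) -> M2 <= x `^ (1 / 3) ->
  Q <= q%:R <= 2 * Q -> x / q%:R `^ (3 / 2 + alpha) <= M3 ->
  (inverse_energy (Num.truncn (2 * M2)) q)%:R <=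
    Q `^ (4 * kappa) * ((2 * M2) ^+ 2 + (2 * M2) ^+ 4 / Q) ->
  max_ternary_sum Delta M1 M2 M3 f1 f2 f3 q <=
    K * (D%:R ^+ 3 * x `^ eps *
           (M2 `^ (5 / 4) * x `^ (1 / 4) * Q `^ (- (1 / 4)) + M2 `^ (3 / 4) * x `^ (1 / 4)) *
           Q `^ (2 * alpha + kappa) + x / Q `^ (1 + alpha / 2)).

Lemma typical_modulus_bound (R : realType) (alpha kappa eps : R) :
  0 < alpha -> alpha < 1 / 100 -> 0 < kappa -> 0 < eps < alpha / 4 ->
  exists K : R, bounds_typical_moduli alpha kappa eps K.
Proof.
move=> a0 a1 k0 /andP[eps0 eps1]; set e := eps / 2.
have e0 : 0 < e by rewrite /e; lra.
have ea : e <= alpha / 8 by rewrite /e; lra.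
have e1 : e <= 1 by rewrite /e; lra.
have [C C1 HC] := tau_bound e0.
have [B B1 HB] := succ_le_pow e0.
have [C' C1' HC'] := coprime_char_sum e0.
have C0 : 0 <= C by apply: le_trans C1.
have B0 : 0 <= B by apply: le_trans B1.
have C0' : 0 <= C' by apply: le_trans C1'.
exists (384 * B * C + 168 * C') => x Q D chi Delta M1 M2 M3 f1 f2 f3 q.
move=> x1 x3 xa Q0 chiD chiQ chiP De0 De1 Mx M32 M21 tw DQ M2x /andP[qQ q2Q] adm hJ.
have x0 : 0 < x by apply: lt_le_trans x1.
have D0 := dirichlet_modulus_gt0 chiD.
have D1 : 1 <= D%:R :> R by rewrite ler1n.
have q0 : 0 < q%:R :> R by apply: lt_le_trans qQ.
have q1' : 1 <= q%:R :> R by move: q0; rewrite ltr0n ler1n.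
have Q512 : 512 <= Q.
  exact: (Q_ge a0 a1 x1 x3 q1' q2Q adm M32 M2x).
have Q1 : 1 <= Q by apply: le_trans Q512; rewrite ler1n.
have q1 : (1 < q)%N.
  by rewrite -(ltr1n R); apply: lt_le_trans qQ; apply: lt_le_trans Q512; rewrite ltr1n.
have M3ge : 1 <= M3.
  have h := short_side_ge a0 a1 x1 Q0 D1 q1' q2Q adm DQ (_ : 0 <= alpha / 8) (lexx _).
  have : 4 * 1 <= 4 * M3; last by rewrite ler_pM2l // ltr0n.
  apply: le_trans (h _); last by rewrite divr_ge0 // ltW.
  apply: le_trans (_ : 1 * 4 * 1 <= _); first by rewrite mul1r.
  apply: ler_pM => //.
    by apply: ler_pM => //; rewrite exprn_ege1.
  by rewrite powR_ge1 // divr_ge0 // ltW.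
have short := short_side_ge a0 a1 x1 Q0 D1 q1' q2Q adm DQ (ltW e0) ea.
have M30 : 0 < M3 by apply: lt_le_trans M3ge.
have M20 : 0 < M2 by apply: lt_le_trans M32.
have M10 : 0 < M1 by apply: lt_le_trans M21.
pose y := x `^ e.
have y1 : 1 <= y by rewrite powR_ge1 // ltW.
have y0 : 0 <= y by apply: le_trans y1.
pose X := 8 * C * y.
have X1 : 1 <= X.
  have Cy : 1 <= C * y by rewrite mulr_ege1.
  by rewrite /X -mulrA mulr_ege1 // ler1n.
have X0 : 0 <= X by apply: le_trans X1.
have powe (b c : R) : 0 <= b -> b <= c -> b `^ e <= c `^ e.
  by move=> b0 bc; apply: (ge0_ler_powR (ltW e0)); rewrite ?nnegrE // (le_trans b0).
have pow_double (c : R) : 0 <= c -> c <= 8 * x -> c `^ e <= 8 * y.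
  move=> c0 cx; apply: le_trans (powe _ _ c0 cx) _.
  by rewrite powRM ?(ltW x0) // ler_wpM2r // ler1_powR // ler1n.
have Qx := Q_le_x a0 a1 x1 Q0 D1 DQ.
have q2x : q%:R <= 2 * x by apply: le_trans q2Q _; rewrite ler_pM2l.
have qe : q%:R `^ e <= 2 * y.
  apply: le_trans (powe _ _ (ltW q0) q2x) _.
  by rewrite powRM ?(ltW x0) // ler_wpM2r // ler1_powR // ler1n.
set N1 := Num.truncn (2 * M1); set N2 := Num.truncn (2 * M2); set N3 := Num.truncn (2 * M3).
have trunc_le (M : R) : 0 < M -> (Num.truncn (2 * M))%:R <= 2 * M.
  by move=> M0; rewrite truncn_le mulr_ge0 // ltW.
have trunc_succ (M : R) : 1 <= M -> (Num.truncn (2 * M)).+1%:R <= 3 * M.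
  move=> M1'; have -> : 3 * M = 2 * M + M by ring.
  by rewrite -natr1 lerD // trunc_le // (lt_le_trans ltr01).
have QM3 : Q * M3 <= x.
  apply: le_trans (_ : x `^ (2 / 3) * x `^ (1 / 3) <= _).
    apply: ler_pM; rewrite ?(ltW Q0) ?(ltW M30) //.
      exact: Q_le_two_thirds a0 a1 x1 Q0 D1 DQ.
    by apply: le_trans M2x.
  rewrite -powRD ?(gt_eqF x0) ?implybT // (_ : 2 / 3 + 1 / 3 = 1); last by field.
  by rewrite powRr1 // ltW.
have taud n : (0 < n)%N -> (n <= q.*2 * N3)%N -> (tau n <= Num.truncn X)%N.
  move=> n0 nq; rewrite truncn_ge_nat //; apply: le_trans (HC n n0) _.
  rewrite /X [8 * C]mulrC -mulrA ler_wpM2l // pow_double //.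
  apply: le_trans (_ : (q.*2 * N3)%:R <= _); first by rewrite ler_nat.
  rewrite natrM -mul2n natrM; apply: le_trans (_ : 2 * (2 * Q) * (2 * M3) <= _).
    by apply: ler_pM => //; [rewrite ler_pM2l | apply: trunc_le].
  have -> : 2 * (2 * Q) * (2 * M3) = 8 * (Q * M3) by ring.
  by rewrite ler_wpM2l ?ler0n.
have quarter (c : R) (n : nat) : (c `^ (1 / 4)) ^+ n = c `^ (n%:R / 4).
  by rewrite -powR_mulrn ?powR_ge0 // -powRrM mul1r mulrC.
have quarterK (c : R) : 0 < c -> (c `^ (1 / 4)) ^+ 4 = c.
  by move=> c0; rewrite quarter divff ?pnatr_eq0 // powRr1 // ltW.
pose u := x `^ (1 / 4); pose m := M2 `^ (1 / 4); pose v := Q `^ (1 / 4); pose k := Q `^ kappa.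
pose Z := u * m ^+ 3 + u * m ^+ 5 / v.
have u0 : 0 <= u by rewrite powR_ge0.
have m0 : 0 <= m by rewrite powR_ge0.
have v0 : 0 < v by rewrite powR_gt0.
have kk0 : 0 <= k by rewrite powR_ge0.
have Z0 : 0 <= Z by rewrite addr_ge0 ?divr_ge0 ?mulr_ge0 ?exprn_ge0 // ltW.
pose w := 12 * (D%:R ^+ 2 * X * k * Z).
have w0 : 0 <= w by rewrite !mulr_ge0.
have k4 : Q `^ (4 * kappa) = k ^+ 4.
  by rewrite -powR_mulrn ?powR_ge0 // -powRrM mulrC.
have w4 : 24 * (D ^ 7 * N3.+1 ^ 3 * N1 * Num.truncn X * inverse_energy N2 q)%:R <= w ^+ 4.
  have -> : (D ^ 7 * N3.+1 ^ 3 * N1 * Num.truncn X * inverse_energy N2 q)%:R =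
      D%:R ^+ 7 * N3.+1%:R ^+ 3 * N1%:R * (Num.truncn X)%:R * (inverse_energy N2 q)%:R :> R.
    by rewrite -!natrX -!natrM.
  rewrite k4 in hJ.
  apply: le_trans (energy_size (ler0n _ D) M20 (ltW M30) M32 (ltW M10) Mx X0 Q0 (ler0n _ _)
    (ler0n _ N1) (ler0n _ N3.+1) (ler0n _ _) (trunc_le M1 M10) (trunc_succ M3 M3ge) _ hJ) _.
    by rewrite truncn_le.
  rewrite /w exprMn ler_wpM2l ?exprn_ge0 //.
  have := fourth_power_le D1 X1 kk0 u0 m0 v0; rewrite !quarterK // -[m ^+ 8]/(m ^+ (4 * 2)).
  by rewrite -[m ^+ 16]/(m ^+ (4 * 4)) !exprM quarterK.
have chiB n : `|\sum_(t < n | coprime t.+1 q) chi t.+1%:Z| <= D%:R * C' * (2 * y).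
  apply: le_trans (HC' (fun t => chi t%:Z) D%:R (dirichlet_muln chiD)
    (fun t => dirichlet_le1 chiD chiQ _) (dirichlet_prefix_sum chiD chiQ) q (ltnW q1) n) _.
  have DC0 : 0 <= D%:R * C' by exact: mulr_ge0.
  by rewrite ler_wpM2l.
have main : N1%:R * (2 * (D%:R * C' * (2 * y))) * N2.+1%:R +
    D%:R * (N3.+1%:R * (2 * D%:R) * N2.+1%:R) <= 42 * C' * (D%:R ^+ 2 * y * (M1 * M2)).
  apply: (main_size (M3 := M3)) => //; rewrite ?(ltW M30) ?(ltW M20) ?(le_trans M32) //.
  - exact: trunc_le.
  - exact: trunc_succ (le_trans M3ge M32).
  - exact: trunc_succ.
have L_le : (trunc_log 2 q).+1%:R <= 2 * B * y.
  apply: le_trans (HB _) _; rewrite [2 * B]mulrC -mulrA ler_wpM2l //.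
  apply: le_trans qe; apply: powe => //.
  by rewrite ler_nat trunc_logP // ltnW.
have Qa : Q `^ (1 + alpha / 2) = Q * Q `^ (alpha / 2).
  by rewrite powRD ?(gt_eqF Q0) ?implybT // powRr1 // ltW.
have Qa0 : 0 < Q `^ (alpha / 2) by rewrite powR_gt0.
have main2 : 42 * C' * (D%:R ^+ 2 * y * (M1 * M2)) / Q <= 168 * C' * (x / Q `^ (1 + alpha / 2)).
  rewrite Qa ler_pdivrMr //.
  have -> : 168 * C' * (x / (Q * Q `^ (alpha / 2))) * Q = 42 * C' * (4 * x / Q `^ (alpha / 2)).
    by field; rewrite !gt_eqF.
  rewrite ler_wpM2l ?mulr_ge0 // ler_pdivlMr //.
  apply: le_trans (_ : 4 * M3 * (M1 * M2) <= _).
    rewrite mulrAC ler_wpM2r ?mulr_ge0 ?(ltW M10) ?(ltW M20) //.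
  by have := Mx; rewrite [M1 * M2 * M3]mulrC => h; rewrite -mulrA ler_pM2l ?ltr0n.
have y2 : y * y = x `^ eps.
  by rewrite /y -powRD ?(gt_eqF x0) ?implybT // /e -splitr.
have ZE : M2 `^ (5 / 4) * x `^ (1 / 4) * Q `^ (- (1 / 4)) + M2 `^ (3 / 4) * x `^ (1 / 4) = Z.
  rewrite powRN -(quarter M2 5) -(quarter M2 3) -/u -/m -/v /Z; ring.
have K1 : 0 <= 384 * B * C by rewrite mulr_ge0 ?mulr_ge0 ?ler0n.
have K2 : 0 <= 168 * C' by rewrite mulr_ge0 ?ler0n.
have err : 2 * (trunc_log 2 q).+1%:R * w <=
    384 * B * C * (D%:R ^+ 3 * x `^ eps * Z * Q `^ (2 * alpha + kappa)).
  apply: le_trans (_ : 2 * (2 * B * y) * w <= _); first by rewrite ler_wpM2r // ler_wpM2l.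
  have -> : 2 * (2 * B * y) * w = 384 * B * C * (D%:R ^+ 2 * (y * y) * Z * k).
    rewrite /w /X; ring.
  rewrite y2; apply: ler_wpM2l K1 _ _ _.
  have xe0 : 0 <= x `^ eps by rewrite powR_ge0.
  have kQ : k <= Q `^ (2 * alpha + kappa) by rewrite /k ler_powR // lerDr mulr_ge0 // ltW.
  have D23 : D%:R ^+ 2 <= D%:R ^+ 3 :> R by rewrite ler_weXn2l.
  have DZ : D%:R ^+ 2 * x `^ eps * Z <= D%:R ^+ 3 * x `^ eps * Z.
    by rewrite ler_wpM2r // ler_wpM2r.
  apply: ler_pM => //; apply: mulr_ge0 => //; apply: mulr_ge0 => //; exact: exprn_ge0.
rewrite ZE.
have T1 : 0 <= D%:R ^+ 3 * x `^ eps * Z * Q `^ (2 * alpha + kappa).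
  by rewrite !(mulr_ge0, powR_ge0, exprn_ge0).
have T2 : 0 <= x / Q `^ (1 + alpha / 2) by rewrite divr_ge0 ?powR_ge0 // ltW.
set A1 := _ * Q `^ _ in T1 err *; set A2 := x / _ in T2 main2 *.
have total : 384 * B * C * A1 + 168 * C' * A2 <= (384 * B * C + 168 * C') * (A1 + A2).
  have -> : (384 * B * C + 168 * C') * (A1 + A2) =
    (384 * B * C * A1 + 168 * C' * A2) + (384 * B * C * A2 + 168 * C' * A1) by ring.
  by rewrite lerDl; apply: addr_ge0; apply: mulr_ge0.
apply: le_trans total; rewrite /max_ternary_sum.
apply: bigmax_le => [|a ca]; first by apply: addr_ge0; apply: mulr_ge0.
have we M : 0 < M -> (window_end Delta M <= (Num.truncn (2 * M)).+1)%N.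
  by move=> ?; apply: window_end_le.
rewrite (ternary_sum_congruence f1 f2 f3 q1 ca De0 M10 M20 M30 (we M2 M20) (we M3 M30)).
have le_n1 : (window_end Delta M1 - window_start M1 <= N1)%N.
  rewrite leq_subLR; apply: leq_trans (we M1 M10) _.
  by rewrite -add1n leq_add2r window_start_gt0.
have N21 : (N2 <= N1)%N by apply: le_truncn; rewrite ler_pM2l.
have N32 : (N3 <= N2)%N by apply: le_truncn; rewrite ler_pM2l.
have DCy : 0 <= D%:R * C' * (2 * y) by rewrite !mulr_ge0.
have bnd := twisted_sum_bound q1 chiD chiQ chiP (window_start_le_end M10 De0) le_n1
  N21 N32 (window_start_gt0 M20) (window_start_gt0 M30)
  (we M2 M20) (we M3 M30) ca DCy taud w0 w4 chiB tw.
rewrite addrC.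
apply: le_trans (lerD main2 err).
have : q%:R * `|congruence_sum (window_start M1) (window_end Delta M1) N2 N3
    (fun t => (window_start M2 <= t < window_end Delta M2)%N && coprime t q)
    (fun t => (window_start M3 <= t < window_end Delta M3)%N && coprime t q)
    (fun t => f1 t%:Z) (fun t => f2 t%:Z) (fun t => f3 t%:Z) (a%:R : 'Z_q)| <=
    42 * C' * (D%:R ^+ 2 * y * (M1 * M2)) + q%:R * (2 * (trunc_log 2 q).+1%:R * w).
  by apply: le_trans bnd _; rewrite lerD2r.
rewrite -ler_pdivlMl // => /le_trans; apply.
rewrite mulrDr mulKf ?gt_eqF // lerD2r mulrC ler_wpM2l ?lef_pV2 ?posrE //.
by rewrite !mulr_ge0 ?sqr_ge0 ?(ltW M10) ?(ltW M20).
Qed.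

Theorem lemma13p2 (R : realType) (C cDelta alpha kappa : R)
    (C_gt0 : 0 < C) (cDelta_gt0 : 0 < cDelta)
    (alpha_gt0 : 0 < alpha) (alpha_lt : alpha < 1 / 100)
    (kappa_gt0 : 0 < kappa) :
  exists (delta K : R -> R) (x0 : R),
    delta Q @[Q --> +oo] --> (0 : R) /\
    forall (x Q : R) (D : nat) (chi : int -> R) (Delta M1 M2 M3 : R)
           (f1 f2 f3 : int -> R),
      x0 <= x -> 0 < Q ->
      exceptional_character C D chi ->
      0 < Delta -> Delta <= cDelta / ln x ^+ 8 ->
      x / ln x ^+ 12 < M1 * M2 * M3 -> M1 * M2 * M3 <= x ->
      M3 <= M2 -> M2 <= M1 ->
      one_twist chi f1 f2 f3 ->
      D%:R ^+ 2 * Q < x `^ (2 / 3 - 4 * alpha) ->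
      M2 <= x `^ (1 / 3) ->
      exists E : seq nat,
        (size E)%:R <= Q `^ (1 - 4 * kappa + delta Q) /\
        forall q : nat,
          Q <= q%:R <= 2 * Q ->
          admissible_modulus alpha x D M1 M3 q ->
          q \notin E ->
          forall epsilon : R, 0 < epsilon < alpha / 4 ->
            max_ternary_sum Delta M1 M2 M3 f1 f2 f3 q <=
            K epsilon *
            (D%:R ^+ 3 * x `^ epsilon *
               (M2 `^ (5 / 4) * x `^ (1 / 4) * Q `^ (- (1 / 4)) +
                M2 `^ (3 / 4) * x `^ (1 / 4)) *
               Q `^ (2 * alpha + kappa) +
             x / Q `^ (1 + alpha / 2)).
Proof.
have /choice[K HK] : forall eps : R, exists K : R,
    0 < eps < alpha / 4 -> bounds_typical_moduli alpha kappa eps K.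
  move=> eps; have [heps|nheps] := boolP (0 < eps < alpha / 4); last by exists 0.
  have [K HK] := typical_modulus_bound alpha_gt0 alpha_lt kappa_gt0 heps.
  by exists K.
have a80 : 0 < alpha / 8 by rewrite divr_gt0.
pose big : R := 1024.
have big0 : 0 <= big by rewrite ler0n.
have [X1 X2 X3] : [/\ 0 < big `^ 3 + 1, 0 < expR (1 + cDelta) & 0 <= 4 `^ (alpha / 8)^-1 :> R].
  by rewrite powR_ge0 expR_gt0 ltr_wpDl // powR_ge0.
exists (delta_exponent (R := R)), K, (big `^ 3 + 1 + expR (1 + cDelta) + 4 `^ (alpha / 8)^-1).
split=> [|x Q D chi Delta M1 M2 M3 f1 f2 f3 xx0 Q0 [chiD chiQ chiP _] De0 De1 _ Mx M32 M21 tw DQ M2x].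
  exact: delta_exponent_cvg.
have B3 : 0 <= big `^ 3 by rewrite powR_ge0.
have x1 : 1 <= x by move: xx0 X2 X3 B3; set z1 := expR _; set z2 := _ `^ _; set z3 := _ `^ _; lra.
have x_gt0 : 0 < x by apply: lt_le_trans x1.
have xc : 1024 <= x `^ (1 / 3).
  apply: (@le_cube_root _ big) => //.
  by move: xx0 X2 X3; set z1 := expR _; set z2 := _ `^ _; set z3 := _ `^ _; lra.
have xa : 4 <= x `^ (alpha / 8).
  have e4 : (4 `^ (alpha / 8)^-1) `^ (alpha / 8) = 4 :> R.
    by rewrite -powRrM mulVf ?gt_eqF // powRr1.
  rewrite -[leLHS]e4; apply: (ge0_ler_powR (ltW a80)); rewrite ?nnegrE ?(ltW x_gt0) //.
  by move: xx0 X1 X2; set z1 := expR _; set z2 := _ `^ _; set z3 := _ `^ _; lra.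
have xe : expR (1 + cDelta) <= x.
  by move: xx0 X1 X3; set z1 := expR _; set z2 := _ `^ _; set z3 := _ `^ _; lra.
have De1' : Delta <= 1.
  have lnx : 1 + cDelta <= ln x by rewrite -[leLHS]expRK ler_ln ?posrE ?expR_gt0.
  have l1 : 1 <= ln x by apply: le_trans lnx; rewrite lerDl ltW.
  apply: le_trans De1 _; rewrite ler_pdivrMr ?exprn_gt0 ?(lt_le_trans ltr01) // mul1r.
  apply: le_trans (_ : ln x ^+ 1 <= _); last by rewrite ler_weXn2l.
  by rewrite expr1; move: lnx; set z := ln x; lra.
have D1 : 1 <= D%:R :> R by rewrite ler1n (dirichlet_modulus_gt0 chiD).
have [[q [/andP[qQ q2Q] [adm _]]]|none] :=
  pselect (exists q : nat, Q <= q%:R <= 2 * Q /\ admissible_modulus alpha x D M1 M3 q).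
  have q1 : 1 <= q%:R :> R by rewrite ler1n -(ltr0n R); apply: lt_le_trans qQ.
  have M30 : 0 < M3.
    by apply: lt_le_trans adm; rewrite divr_gt0 // powR_gt0 // (lt_le_trans _ q1).
  have Q512 := Q_ge alpha_gt0 alpha_lt x1 xc q1 q2Q adm M32 M2x.
  have M2Q := le_trans M2x (cube_root_le_modulus alpha_gt0 alpha_lt x1 q1 q2Q adm M32 M2x).
  have [E [sE HE]] := exceptional_moduli kappa Q512 (lt_le_trans M30 M32) M2Q.
  exists E; split=> // q' hq' [adm' _] qE eps heps.
  exact: (HK eps heps x Q D chi Delta M1 M2 M3 f1 f2 f3 q' x1 xc xa Q0 chiD chiQ chiP
    De0 De1' Mx M32 M21 tw DQ M2x hq' adm' (HE q' hq' qE)).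
exists [::]; split=> [|q hq adm _ eps _]; first by rewrite powR_ge0.
by case: none; exists q.
Qed.
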